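(* Let $k$ be an algebraically closed field. Let $g=(a,b,c,d)\in\mathbb Z^4$ be the $g$-vector of a band semibrick over $\Lambda_4$, equivalently, let $a,b,c,d$ be integers with $a\le0$, $a+b\le0$, $a+b+c\le0$ and $a+b+c+d=0$. Then $g$ is the $g$-vector of a one-parameter family of band bricks over $\Lambda_4$ if and only if either $\gcd(a+b,b+c)=1$ and $a+b\neq0$, or $(a,b,c,d)=(-1,1,0,0)$, or $(a,b,c,d)=(0,0,-1,1)$.
   Context: The algebra $\Lambda_4$. $Q_4$ is the quiver with vertices $1,2,3,4$ and, for each $1\le i\le 3$, two arrows $\alpha_i,\beta_i:i+1\to i$. $R_4=\{\alpha_i\beta_{i+1},\ \beta_i\alpha_{i+1}:1\le i\le 2\}$ (paths composed right to left), $\Lambda_4=kQ_4/(R_4)$; modules are finite-dimensional left modules, i.e. representations of $(Q_4,R_4)$. $P_i=\Lambda_4e_i$ is the indecomposable projective at vertex $i$. If $\bigoplus_i P_i^{\oplus b_i}\to\bigoplus_iP_i^{\oplus a_i}\to X\to0$ is the minimal projective presentation of $X$, the $g$-vector of $X$ is $g(X)=(a_i-b_i)_{1\le i\le4}$. Band modules. A walk $z=\gamma_r\cdots\gamma_1$ is a sequence of arrows or formal inverses of arrows (source and target exchanged), the target of $\gamma_s$ being the source of $\gamma_{s+1}$; $\gamma_s$ goes from $v_{s-1}$ to $v_s$. It is a string walk if $\gamma_{s+1}\ne\gamma_s^{-1}$ and neither $\gamma_{s+1}\gamma_s$ nor its inverse is in $R_4$, for all $s$. A band walk is a string walk of positive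 length with $v_0=v_r$, not a proper power of another walk, all of whose powers are string walks. For a band walk $z$ and $\lambda\in k^\times$, $B_{z,1,\lambda}$ has basis $\epsilon_0,\dots,\epsilon_{r-1}$ with $\epsilon_s$ at vertex $v_s$ (and $\epsilon_r=\epsilon_0$); if $\gamma_s=\gamma$ is an arrow then $\gamma\epsilon_{s-1}=\epsilon_s$ for $s<r$ and $\gamma\epsilon_{r-1}=\lambda\epsilon_r$ for $s=r$; if $\gamma_s=\gamma^{-1}$ then $\gamma\epsilon_s=\epsilon_{s-1}$ for $s<r$ and $\gamma\epsilon_r=\lambda^{-1}\epsilon_{r-1}$ for $s=r$; all other actions of arrows are zero. A brick is a module with endomorphism ring $k$. Band bricks are the bricks of the form $B_{z,1,\lambda}$. A band semibrick is a finite (possibly empty) direct sum of band bricks with no non-zero morphisms between distinct summands. A one-parameter family of band bricks is a family $\{B_{z,1,\lambda}:\lambda\in k^\times\}$ all of whose members are bricks; all members have the same $g$-vector, which is the $g$-vector of the family. *)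

(* Defs.v *)
From HB Require Import structures.
From mathcomp Require Import all_boot all_order all_algebra.
Set Implicit Arguments. Unset Strict Implicit. Unset Printing Implicit Defensive.
Import Order.TTheory GRing.Theory Num.Theory.
Local Open Scope ring_scope.

(* The vertex i of Q_4 is the ordinal of value i - 1; the arrow alpha_i
   (resp. beta_i) : i+1 -> i is the pair (i - 1, true) (resp. (i - 1, false)). *)
Definition vertex := 'I_4.
Definition arrow := ('I_3 * bool)%type.

Definition src (x : arrow) : vertex := lift ord0 x.1.
Definition tgt (x : arrow) : vertex := widen_ord (leqnSn 3) x.1.

(* [rel4 x y] says that the path x y (y first, then x) belongs to R_4. *)
Definition rel4 (x y : arrow) : bool := (src x == tgt y) && (x.2 != y.2).

(* The data of a left module over Lambda_4 on the column space k^n: e_i acts as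
   [e i] and the arrow x as [A x].  The conditions are those of the presentation
   of k Q_4 / (R_4) by the generators e_i and x. *)
Definition lambda4_axiom (k : fieldType) n (e : vertex -> 'M[k]_n)
    (A : arrow -> 'M[k]_n) : Prop :=
  [/\ forall i j, e i *m e j = if i == j then e i else 0,
      \sum_i e i = 1%:M,
      forall x, e (tgt x) *m A x *m e (src x) = A x
    & forall x y, rel4 x y -> A x *m A y = 0].

Record lmodule4 (k : fieldType) := Lmodule4 {
  mdim : nat;
  midem : vertex -> 'M[k]_mdim;
  mact : arrow -> 'M[k]_mdim;
  maxiom : lambda4_axiom midem mact }.

Definition is_hom (k : fieldType) (M N : lmodule4 k)
    (f : 'M[k]_(mdim N, mdim M)) : Prop :=
  (forall i, f *m midem M i = midem N i *m f) /\
  (forall x, f *m mact M x = mact N x *m f).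

Definition surj (k : fieldType) m n (f : 'M[k]_(m, n)) : Prop :=
  forall y : 'cV[k]_m, exists x : 'cV[k]_n, f *m x = y.

(* End(M) = k: the canonical map k -> End(M) is bijective. *)
Definition brick (k : fieldType) (M : lmodule4 k) : Prop :=
  (0 < mdim M)%N /\
  forall f : 'M[k]_(mdim M), @is_hom k M M f -> exists c : k, f = c%:M.

Lemma zero_axiom (k : fieldType) :
  @lambda4_axiom k 0 (fun=> 0) (fun=> 0).
Proof. by split=> *; apply/matrixP=> -[]. Qed.

Definition zero_mod (k : fieldType) : lmodule4 k := Lmodule4 (zero_axiom k).

Lemma dsum_axiom (k : fieldType) (M N : lmodule4 k) :
  lambda4_axiom (fun i => block_mx (midem M i) 0 0 (midem N i))
                (fun x => block_mx (mact M x) 0 0 (mact N x)).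
Proof.
case: (maxiom M) => M1 M2 M3 M4; case: (maxiom N) => N1 N2 N3 N4.
split=> [i j||x|x y xy].
- rewrite mulmx_block !mulmx0 !mul0mx !addr0 !add0r M1 N1.
  by case: eqP => // _; rewrite block_mx0.
- rewrite (_ : 1%:M = block_mx (\sum_i midem M i) 0 0 (\sum_i midem N i)).
    elim/big_ind3: _ => [|A a b B c d -> ->|//].
      by rewrite block_mx0.
    by rewrite add_block_mx !addr0.
  by rewrite M2 N2 -scalar_mx_block.
- by rewrite !mulmx_block !(mulmx0, mul0mx, addr0, add0r) M3 N3.
- by rewrite mulmx_block !(mulmx0, mul0mx, addr0, add0r) M4 // N4 // block_mx0.
Qed.

Definition dsum (k : fieldType) (M N : lmodule4 k) : lmodule4 k :=
  Lmodule4 (dsum_axiom M N).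

Definition dsums (k : fieldType) (s : seq (lmodule4 k)) : lmodule4 k :=
  foldr (@dsum k) (zero_mod k) s.

(* The module with basis T, the basis vector t lying at the vertex [v t], on
   which the arrow x maps the basis vector p to \sum_q c x q p * q. *)
Section BasisModule.
Variables (k : fieldType) (T : finType) (v : T -> vertex).
Variable c : arrow -> T -> T -> k.
Hypothesis c_vertex :
  forall x q p, c x q p != 0 -> v p = src x /\ v q = tgt x.
Hypothesis c_rel :
  forall x y r q p, rel4 x y -> c x r q != 0 -> c y q p != 0 -> False.

Lemma basis_axiom :
  lambda4_axiom
    (fun i => diag_mx (\row_(t < #|T|) (v (enum_val t) == i)%:R) : 'M[k]_#|T|)
    (fun x => \matrix_(q, p) c x (enum_val q) (enum_val p)).
Proof.
split=> [i j||x|x y xy].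
- rewrite mulmx_diag; case: eqP => [<-|ij].
    congr diag_mx; apply/rowP=> t; rewrite !mxE.
    by case: eqP => _; rewrite ?mulr1 ?mulr0.
  apply/matrixP=> s t; rewrite !mxE.
  have [ij1|_] := eqVneq (v (enum_val s)) i; last by rewrite mul0r mul0rn.
  have [ij2|_] := eqVneq (v (enum_val s)) j; last by rewrite mulr0 mul0rn.
  by case: ij; rewrite -ij1.
- apply/matrixP=> s t; rewrite summxE.
  under eq_bigr do rewrite !mxE.
  rewrite mxE; case: eqP => [->|_]; last by under eq_bigr do rewrite mulr0n; rewrite big1.
  rewrite (bigD1 (v (enum_val t))) //= eqxx big1 ?addr0 // => i.
  by rewrite eq_sym => /negbTE ->.
- apply/matrixP=> q p; rewrite mul_mx_diag mul_diag_mx !mxE.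
  have [->|/c_vertex[-> ->]] := eqVneq (c x (enum_val q) (enum_val p)) 0.
    by rewrite mulr0 mul0r.
  by rewrite !eqxx mul1r mulr1.
- apply/matrixP=> r p; rewrite !mxE big1 // => q _; rewrite !mxE.
  have [->|cx] := eqVneq (c x (enum_val r) (enum_val q)) 0; first exact: mul0r.
  have [->|cy] := eqVneq (c y (enum_val q) (enum_val p)) 0; first exact: mulr0.
  by case: (c_rel xy cx cy).
Qed.

Definition basis_mod : lmodule4 k := Lmodule4 basis_axiom.
End BasisModule.

(* A path is the list of its arrows, the first arrow to be followed coming first.
   The non-zero paths starting at i form a basis of P_i = Lambda_4 e_i, on which
   an arrow x acts by p |-> x p; every path of Q_4 has length at most 3. *)
Definition nzpath_from (i : vertex) (p : seq arrow) : bool :=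
  (if p is x :: _ then src x == i else true) &&
  sorted (fun x y => (tgt x == src y) && ~~ rel4 y x) p.

Definition path_end (i : vertex) (p : seq arrow) : vertex := last i (map tgt p).

Definition proj_basis (i : vertex) : finType :=
  {p : {bseq 3 of arrow} | nzpath_from i p}.

Definition proj_coef (k : fieldType) (i : vertex) (x : arrow)
    (q p : proj_basis i) : k :=
  (val (val q) == rcons (val (val p)) x)%:R.

Lemma proj_coef_neq0 (k : fieldType) (i : vertex) x (q p : proj_basis i) :
  proj_coef k x q p != 0 -> val (val q) = rcons (val (val p)) x.
Proof.
rewrite /proj_coef.
by have [->|_] := eqVneq (val (val q)) (rcons (val (val p)) x); rewrite ?eqxx.
Qed.

Lemma path_end_rcons i p x : nzpath_from i (rcons p x) ->
  path_end i p = src x /\ path_end i (rcons p x) = tgt x.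
Proof.
rewrite /nzpath_from /path_end map_rcons last_rcons.
case: p => [|y s] /=; first by rewrite andbT => /eqP.
by rewrite rcons_path => /andP[_ /andP[_ /andP[/eqP <- _]]]; rewrite last_map.
Qed.

Lemma proj_vertex (k : fieldType) (i : vertex) x (q p : proj_basis i) :
  proj_coef k x q p != 0 ->
  path_end i (val p) = src x /\ path_end i (val q) = tgt x.
Proof.
move/proj_coef_neq0 => qE; have := valP q; rewrite /= qE.
exact: path_end_rcons.
Qed.

Lemma proj_rel (k : fieldType) (i : vertex) x y (r q p : proj_basis i) :
  rel4 x y -> proj_coef k x r q != 0 -> proj_coef k y q p != 0 -> False.
Proof.
move=> xy /proj_coef_neq0 rE /proj_coef_neq0 qE.
have := valP r; rewrite /nzpath_from /= rE qE.
case: (val (val p)) => [|z s] /=; first by rewrite xy !andbF.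
by rewrite !rcons_path last_rcons xy !andbF.
Qed.

Definition proj (k : fieldType) (i : vertex) : lmodule4 k :=
  basis_mod (@proj_vertex k i) (@proj_rel k i).

(* \bigoplus_i P_i^{a_i} *)
Definition projs (k : fieldType) (a : vertex -> nat) : lmodule4 k :=
  dsums (flatten [seq nseq (a i) (proj k i) | i <- enum 'I_4]).

(* f : M -> N is an essential epimorphism onto its image: a morphism h to M is
   surjective as soon as f h has the same image as f. *)
Definition essential (k : fieldType) (M N : lmodule4 k)
    (f : 'M[k]_(mdim N, mdim M)) : Prop :=
  forall (L : lmodule4 k) (h : 'M[k]_(mdim M, mdim L)), is_hom h ->
    (forall y : 'cV[k]_(mdim M), exists x : 'cV[k]_(mdim L),
       f *m (h *m x) = f *m y) ->
    surj h.

(* P1 --f--> P0 --p--> X --> 0 is exact, and P0 -> X and P1 -> ker p = im f are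
   projective covers. *)
Definition min_presentation (k : fieldType) (P1 P0 X : lmodule4 k)
    (f : 'M[k]_(mdim P0, mdim P1)) (p : 'M[k]_(mdim X, mdim P0)) : Prop :=
  [/\ is_hom f /\ is_hom p,
      surj p,
      forall x : 'cV[k]_(mdim P0),
        p *m x = 0 <-> exists y : 'cV[k]_(mdim P1), f *m y = x,
      essential p
    & essential f].

Definition is_gvector (k : fieldType) (X : lmodule4 k) (g : 4.-tuple int) : Prop :=
  exists (a b : vertex -> nat)
         (f : 'M[k]_(mdim (projs k a), mdim (projs k b)))
         (p : 'M[k]_(mdim X, mdim (projs k a))),
    min_presentation f p /\ forall i, tnth g i = (a i)%:Z - (b i)%:Z.

(* (x, false) is the arrow x and (x, true) its formal inverse.  The walk
   gamma_r ... gamma_1 is the list [:: gamma_1; ...; gamma_r]. *)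
Definition letter := (arrow * bool)%type.
Definition lsrc (l : letter) : vertex := if l.2 then tgt l.1 else src l.1.
Definition ltgt (l : letter) : vertex := if l.2 then src l.1 else tgt l.1.
Definition linv (l : letter) : letter := (l.1, ~~ l.2).

Definition lrel4 (l m : letter) : bool := [&& ~~ l.2, ~~ m.2 & rel4 l.1 m.1].

Definition is_walk (z : seq letter) : bool :=
  sorted (fun l m => ltgt l == lsrc m) z.

(* l = gamma_s and m = gamma_{s+1}; the inverse of m l is l^-1 m^-1. *)
Definition string_step (l m : letter) : bool :=
  [&& ltgt l == lsrc m, m != linv l, ~~ lrel4 m l & ~~ lrel4 (linv l) (linv m)].

Definition string_walk (z : seq letter) : bool := sorted string_step z.

Definition closed_walk (z : seq letter) : bool :=
  if z is l :: s then ltgt (last l s) == lsrc l else false.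

Definition walk_pow (z : seq letter) (n : nat) : seq letter :=
  flatten (nseq n z).

Definition band_walk (z : seq letter) : Prop :=
  [/\ string_walk z,
      closed_walk z,
      forall w n, is_walk w -> (1 < n)%N -> z <> walk_pow w n
    & forall n, string_walk (walk_pow z n)].

Record band := Band { bwalk : seq letter; bwalkP : band_walk bwalk }.

Section BandModule.
Variables (k : fieldType) (z : band) (lambda : k).
Local Notation r := (size (bwalk z)).

(* [bletter t] is gamma_{t+1}, joining epsilon_t to epsilon_{t+1}, where
   epsilon_r = epsilon_0; so v_t is its source. *)
Definition bletter (t : 'I_r) : letter := tnth (in_tuple (bwalk z)) t.
Definition bvertex (t : 'I_r) : vertex := lsrc (bletter t).

Definition bscalar (t : 'I_r) : k := if t.+1 == r then lambda else 1.

(* The coefficient of epsilon_q in x epsilon_p. *)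
Definition band_coef (x : arrow) (q p : 'I_r) : k :=
  if (bletter p == (x, false)) && (q == ordS p) then bscalar p
  else if (bletter q == (x, true)) && (p == ordS q) then (bscalar q)^-1
  else 0.

Lemma band_coef_neq0 x q p : band_coef x q p != 0 ->
  (bletter p = (x, false) /\ q = ordS p) \/
  (bletter q = (x, true) /\ p = ordS q).
Proof.
rewrite /band_coef; case: ifP => [/andP[/eqP ? /eqP ?] _|_]; first by left.
by case: ifP => [/andP[/eqP ? /eqP ?] _|_]; [right | rewrite eqxx].
Qed.

Lemma band_step t : string_step (bletter t) (bletter (ordS t)).
Proof.
case: (bwalkP z) => _ _ _ /(_ 2%N); rewrite /string_walk /walk_pow /= cats0.
pose l0 := bletter t.
move/(sortedP l0)/(_ t); rewrite size_cat !nth_cat !ltn_ord.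
have ltr : (t.+1 < r + r)%N by rewrite -addn1 leq_add // (leq_ltn_trans _ (ltn_ord t)).
move/(_ ltr); rewrite /bletter !(tnth_nth l0) /=.
have [lt|] := ltnP t.+1 r; first by rewrite modn_small.
move=> ge; have -> : t.+1 = r by apply/eqP; rewrite eqn_leq ge ltn_ord.
by rewrite subnn modnn.
Qed.

Lemma band_vertex x q p : band_coef x q p != 0 ->
  bvertex p = src x /\ bvertex q = tgt x.
Proof.
rewrite /bvertex => /band_coef_neq0[[lE ->]|[lE ->]]; rewrite lE.
  by have /and4P[/eqP<- _ _ _] := band_step p; rewrite lE.
by have /and4P[/eqP<- _ _ _] := band_step q; rewrite lE.
Qed.

Lemma band_rel x y s q p :
  rel4 x y -> band_coef x s q != 0 -> band_coef y q p != 0 -> False.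
Proof.
move=> xy /band_coef_neq0[[l1 E1]|[l1 E1]] /band_coef_neq0[[l2 E2]|[l2 E2]].
- have /and4P[_ _ /negP[]] := band_step p.
  by rewrite -E2 l1 l2 /lrel4 /= xy.
- by rewrite l1 in l2.
- have E : s = p by apply: (bij_inj (ordS_bij r)); rewrite -E1 -E2.
  by rewrite E l2 in l1.
- have /and4P[_ _ _ /negP[]] := band_step s.
  by rewrite -E1 l1 l2 /lrel4 /= xy.
Qed.

(* B_{z,1,lambda}, for lambda != 0. *)
Definition band_mod : lmodule4 k := basis_mod band_vertex band_rel.
End BandModule.

Definition band_brick (k : fieldType) (M : lmodule4 k) : Prop :=
  (exists (z : band) (lambda : k), lambda != 0 /\ M = band_mod z lambda) /\
  brick M.

(* Summands at distinct positions are distinct, even if they are isomorphic. *)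
Definition band_semibrick (k : fieldType) (S : lmodule4 k) : Prop :=
  exists s : seq (lmodule4 k),
    [/\ S = dsums s,
        forall i, (i < size s)%N -> band_brick (nth (zero_mod k) s i)
      & forall i j, (i < size s)%N -> (j < size s)%N -> i != j ->
          forall f : 'M[k]_(mdim (nth (zero_mod k) s j),
                            mdim (nth (zero_mod k) s i)),
            is_hom f -> f = 0].

Definition is_band_brick_family (k : fieldType) (z : band) : Prop :=
  forall lambda : k, lambda != 0 -> brick (band_mod z lambda).

Definition is_family_gvector (k : fieldType) (z : band) (g : 4.-tuple int) : Prop :=
  forall lambda : k, lambda != 0 -> is_gvector (band_mod z lambda) g.

(* Main.v *)
(** The colour of the arrows changes at every peak and every deep of a band walk, so that
a band is a closed walk on the line 1 - 2 - 3 - 4 which descends along one colour and climbs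
along the other.  If it climbs x, y, w times along the edges 1 - 2, 2 - 3, 3 - 4, then its
g-vector is (-x, x - y, y - w, w): the band module is resolved by the projectives at its
peaks and its deeps.  This gives the inequalities.

Conversely, given x, y, w >= 0, put x, x + y, y + w, w points on the four levels and join
them by x, y, w descending and x, y, w climbing strands without changing the order inside a
bundle, so that at each level the descending strands leave below the climbing ones while
those which arrive from above arrive below those which arrive from below.  The closed curves
so obtained are bands.  A nonzero morphism between two of them follows two strands until they
diverge, in the past and in the future, in ways which would force them to change their order;
so the strands are parallel for ever, and the curves are bricks which are pairwise orthogonal
for distinct parameters.  The first return to y of the points at level 2 is the translation
by w - x modulo y, so there is a single curve if gcd (y, x - w) = 1.

Finally, order the positions at each height of a band brick lexicographically by their
future directions.  A morphism forbidden by the brick condition arises unless this order agrees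
with the one given by the past, and then the rank of a position modulo a common divisor
of y and x - w is constant along the band, although the ranks 0 and 1 occur at level 2 as
soon as y > 1. *)
Require Import Defs.
From mathcomp Require Import all_boot all_order all_algebra.
From mathcomp Require Import zify ring.
Set Implicit Arguments. Unset Strict Implicit. Unset Printing Implicit Defensive.
Import Order.TTheory GRing.Theory Num.Theory.
Local Open Scope ring_scope.

(** * Modules and projectives *)

Section Modules.
Variable k : fieldType.
Implicit Types (M N L : lmodule4 k).

Lemma midem_id M i : midem M i *m midem M i = midem M i.
Proof. by case: (maxiom M) => -> _ _ _; rewrite eqxx. Qed.

Lemma midem_orth M i j : i != j -> midem M i *m midem M j = 0.
Proof. by case: (maxiom M) => -> _ _ _ /negbTE ->. Qed.

Lemma mact_src M x : mact M x *m midem M (src x) = mact M x.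
Proof.
by case: (maxiom M) => _ _ E _; rewrite -{1}[mact M x]E -mulmxA midem_id E.
Qed.

Lemma mact_tgt M x : midem M (tgt x) *m mact M x = mact M x.
Proof.
by case: (maxiom M) => _ _ E _; rewrite -{1}[mact M x]E !mulmxA midem_id E.
Qed.

Lemma midem_mact0 M i x : i != tgt x -> midem M i *m mact M x = 0.
Proof. by move=> ix; rewrite -mact_tgt mulmxA midem_orth ?mul0mx. Qed.

Lemma mact_midem0 M i x : src x != i -> mact M x *m midem M i = 0.
Proof. by move=> ix; rewrite -mact_src -mulmxA midem_orth ?mulmx0. Qed.

Lemma midem_sum M (y : 'cV[k]_(mdim M)) : y = \sum_i midem M i *m y.
Proof. by case: (maxiom M) => _ E _ _; rewrite -mulmx_suml E mul1mx. Qed.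

(** Submodules are predicates on column vectors, so that images and radicals require no choice of a
    basis. *)
Definition stable M (U : 'cV[k]_(mdim M) -> Prop) : Prop :=
  [/\ U 0, forall x y, U x -> U y -> U (x + y), forall c x, U x -> U (c *: x)
    & forall a x, U x -> U (mact M a *m x)].

Lemma stable_sum M (U : 'cV[k]_(mdim M) -> Prop) (I : Type) (s : seq I)
    (P : pred I) F :
  stable U -> (forall i, P i -> U (F i)) -> U (\sum_(i <- s | P i) F i).
Proof. by case=> U0 UD _ _ UF; elim/big_rec: _ => // i x Pi Ux; apply/UD/Ux/UF. Qed.

Arguments stable_sum {M U I s P F}.

Lemma stable_im M N (h : 'M[k]_(mdim N, mdim M)) : is_hom h ->
  stable (fun y => exists x : 'cV_(mdim M), h *m x = y).
Proof.
move=> [_ hA]; split.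
- by exists 0; rewrite mulmx0.
- by move=> _ _ [x <-] [y <-]; exists (x + y); rewrite mulmxDr.
- by move=> c _ [x <-]; exists (c *: x); rewrite scalemxAr.
- by move=> a _ [x <-]; exists (mact M a *m x); rewrite mulmxA hA mulmxA.
Qed.

(** A generator carries the vertex at which it lies, hence the projective which maps onto the
    submodule it generates. *)
Definition generates M (G : seq (vertex * 'cV[k]_(mdim M))) : Prop :=
  (forall p, p \in G -> midem M p.1 *m p.2 = p.2) /\
  forall U, stable U -> (forall p, p \in G -> U p.2) -> forall y, U y.

Lemma hom_comp L M N (g : 'M[k]_(mdim N, mdim M)) (f : 'M[k]_(mdim M, mdim L)) :
  is_hom g -> is_hom f -> is_hom (g *m f).
Proof.
move=> [g1 g2] [f1 f2].
by split=> i; rewrite -mulmxA (f1, f2) mulmxA (g1, g2) mulmxA.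
Qed.

(* The hypothesis says M = im h + rad M; the components of M lie in im h by downward
   induction on the vertex. *)
Lemma nakayama L M (h : 'M[k]_(mdim M, mdim L)) : is_hom h ->
  (forall y : 'cV_(mdim M), exists (x : 'cV_(mdim L)) (r : arrow -> 'cV_(mdim M)),
     y = h *m x + \sum_a mact M a *m r a) -> surj h.
Proof.
move=> hh H; have sU := stable_im hh; set U := fun y => _ in sU.
have [U0 UD UZ UA] := sU.
suff E n (i : vertex) : (4 <= n + i)%N -> forall y, U (midem M i *m y).
  move=> y; suff: U y by []; rewrite [y]midem_sum.
  by apply: (stable_sum sU) => i _; apply: (E 4).
elim: n i => [|n IH] i ni y; first by have := ltn_ord i; lia.
have [x [r ->]] := H y; rewrite mulmxDr; apply: UD.
  by rewrite mulmxA -hh.1 -mulmxA; exists (midem L i *m x).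
rewrite mulmx_sumr; apply: (stable_sum sU) => a _; rewrite mulmxA.
have [it|it] := eqVneq i (tgt a); last by rewrite midem_mact0 ?mul0mx.
rewrite it mact_tgt -mact_src -mulmxA; apply: (UA); apply: IH.
by move: ni; rewrite it /tgt /src /= /bump /=; lia.
Qed.

Fixpoint pact N (p : seq arrow) (n : 'cV[k]_(mdim N)) : 'cV[k]_(mdim N) :=
  if p is x :: p' then pact p' (mact N x *m n) else n.

Lemma pact_rcons N p x (n : 'cV_(mdim N)) :
  pact (rcons p x) n = mact N x *m pact p n.
Proof. by elim: p n => //= y p IH n; rewrite IH. Qed.

Lemma pact_end N i p (n : 'cV_(mdim N)) : midem N i *m n = n ->
  midem N (path_end i p) *m pact p n = pact p n.
Proof.
move=> Hn; elim/last_ind: p => [|p x IH] //.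
by rewrite pact_rcons /path_end map_rcons last_rcons mulmxA mact_tgt.
Qed.

(** If a nonzero path cannot be continued by [x], then either [x] does not start at its end, or its
    last arrow and [x] form a relation. *)
Lemma pact_rel N i p x (n : 'cV_(mdim N)) : midem N i *m n = n ->
  nzpath_from i p -> ~~ nzpath_from i (rcons p x) -> mact N x *m pact p n = 0.
Proof.
move=> Hn; have := pact_end p Hn; case/lastP: p => [|p y] => [_ _|].
  rewrite /nzpath_from /= andbT => ix.
  by rewrite -Hn mulmxA mact_midem0 ?mul0mx.
rewrite /path_end map_rcons last_rcons => Hy np.
have -> : nzpath_from i (rcons (rcons p y) x) =
    nzpath_from i (rcons p y) && ((tgt y == src x) && ~~ rel4 x y).
  rewrite /nzpath_from; case: p {Hy np} => [|z p] /=; first by rewrite !andbT.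
  by rewrite (rcons_path _ _ (rcons p y)) last_rcons andbA.
rewrite np /= negb_and negbK => /orP[ne|xy].
  by rewrite -Hy mulmxA mact_midem0 ?mul0mx // eq_sym.
rewrite pact_rcons mulmxA; case: (maxiom N) => _ _ _ E; rewrite E ?mul0mx //.
Qed.

(** Each arrow lowers the vertex by one. Hence nonzero paths have length at most 3, and the length
    bound in [proj_basis] never prevents a nonzero extension. *)
Lemma nzpath_size i p : nzpath_from i p -> (size p + path_end i p)%N = i.
Proof.
elim/last_ind: p => [|p x IH] //= np; have [E1 E2] := path_end_rcons np.
have np' : nzpath_from i p.
  move: np; rewrite /nzpath_from; case: p {IH E1 E2} => //= y p.
  by rewrite rcons_path; case/andP=> -> /andP[->].
by rewrite -[RHS](IH np') size_rcons E1 E2 /src /tgt /= /bump /=; lia.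
Qed.

(** The map from [P_i] which sends the trivial path to [n]; it is a morphism as soon as [n] lies at
    the vertex [i]. *)
Definition proj_hom N i (n : 'cV[k]_(mdim N)) : 'M[k]_(mdim N, mdim (proj k i)) :=
  \matrix_(a, q) pact (val (val (enum_val q))) n a ord0.

Definition proj_vec i (q : proj_basis i) : 'cV[k]_(mdim (proj k i)) :=
  delta_mx (enum_rank q) 0.

Lemma proj_homE N i (n : 'cV_(mdim N)) (q : proj_basis i) :
  proj_hom i n *m proj_vec q = pact (val (val q)) n.
Proof.
by rewrite -colE; apply/colP=> a; rewrite !mxE enum_rankK.
Qed.

Lemma basis_act (T : finType) v c H1 H2 x (p : T) :
  mact (@basis_mod k T v c H1 H2) x *m (delta_mx (enum_rank p) 0 : 'cV_#|T|) =
  \sum_q c x q p *: delta_mx (enum_rank q) 0.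
Proof.
rewrite -colE; apply/colP=> a; rewrite !mxE summxE enum_rankK.
rewrite (bigD1 (enum_val a)) //= big1 => [|q qa].
  by rewrite !mxE enum_valK !eqxx mulr1 addr0.
rewrite !mxE andbT; case: eqP => [E|]; last by rewrite mulr0.
by rewrite E enum_rankK eqxx in qa.
Qed.

Lemma basis_idem (T : finType) v c H1 H2 i (p : T) :
  midem (@basis_mod k T v c H1 H2) i *m (delta_mx (enum_rank p) 0 : 'cV_#|T|) =
  (v p == i)%:R *: delta_mx (enum_rank p) 0.
Proof.
rewrite -colE; apply/colP=> a; rewrite !mxE /= andbT.
have [->|_] := eqVneq a (enum_rank p); rewrite ?mulr1n ?mulr0n ?enum_rankK ?mulr1 ?mulr0 //.
Qed.

Lemma delta_ext m (T : finType) (A B : 'M[k]_(m, #|T|)) :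
  (forall t : T, A *m (delta_mx (enum_rank t) 0 : 'cV_#|T|) = B *m delta_mx (enum_rank t) 0) ->
  A = B.
Proof.
move=> E; apply/matrixP=> i j; have := E (enum_val j).
by rewrite enum_valK -!colE => /colP/(_ i); rewrite !mxE.
Qed.

Lemma delta_sum (T : finType) (y : 'cV[k]_#|T|) :
  y = \sum_(t : T) y (enum_rank t) 0 *: (delta_mx (enum_rank t) 0 : 'cV_#|T|).
Proof.
apply/colP=> a; rewrite summxE (bigD1 (enum_val a)) //= big1 => [|q qa].
  by rewrite !mxE enum_valK !eqxx mulr1 addr0.
rewrite !mxE andbT; case: eqP => [E|]; last by rewrite mulr0.
by rewrite E enum_rankK eqxx in qa.
Qed.

Lemma proj_act i x (p : proj_basis i) :
  (exists q : proj_basis i, val (val q) = rcons (val (val p)) x /\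
     mact (proj k i) x *m proj_vec p = proj_vec q) \/
  (~~ nzpath_from i (rcons (val (val p)) x) /\ mact (proj k i) x *m proj_vec p = 0).
Proof.
rewrite /proj_vec basis_act /proj_coef; have [np|np] := boolP (nzpath_from _ _).
  left; have sz : (size (rcons (val (val p)) x) <= 3)%N.
    by rewrite -ltnS; apply: leq_ltn_trans (ltn_ord i); rewrite -(nzpath_size np) leq_addr.
  pose q : proj_basis i := Sub (Bseq sz) np; exists q; split=> //.
  rewrite (bigD1 q) //= eqxx scale1r big1 ?addr0 // => q' /eqP qq'.
  case: eqP => [E|_]; last by rewrite scale0r.
  by case: qq'; do 2!apply: val_inj.
right; split=> //; rewrite big1 // => q _; case: eqP => [E|_]; last by rewrite scale0r.
by rewrite -E (valP q) in np.
Qed.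

Lemma proj_hom_hom N i (n : 'cV_(mdim N)) : midem N i *m n = n -> is_hom (proj_hom i n).
Proof.
move=> Hn; split=> [j|x]; apply: delta_ext => p.
  rewrite -!mulmxA basis_idem -scalemxAr !proj_homE.
  rewrite -(pact_end _ Hn) mulmxA; case: eqVneq => [->|ne].
    by rewrite midem_id scale1r.
  by rewrite scale0r midem_orth ?mul0mx // eq_sym.
rewrite -!mulmxA -/(proj_vec p) proj_homE.
have [[q [E ->]]|[np ->]] := proj_act x p; first by rewrite proj_homE E pact_rcons.
by rewrite mulmx0 (pact_rel Hn) // (valP p).
Qed.

Definition proj_triv i : proj_basis i := Sub (@Bseq 3 _ [::] isT) isT.
Definition proj_gen i : 'cV[k]_(mdim (proj k i)) := proj_vec (proj_triv i).

Lemma proj_gen_idem i : midem (proj k i) i *m proj_gen i = proj_gen i.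
Proof. by rewrite /proj_gen /proj_vec basis_idem eqxx scale1r. Qed.

Lemma proj_vec_pact i (q : proj_basis i) : proj_vec q = pact (val (val q)) (proj_gen i).
Proof.
suff E p (sz : (size p <= 3)%N) (np : nzpath_from i p) :
    proj_vec (Sub (Bseq sz) np : proj_basis i) = pact p (proj_gen i).
  by case: q => -[p sz] np; rewrite -(E p sz np).
elim/last_ind: p sz np => [|p x IH] sz np.
  by congr proj_vec; do 2!apply: val_inj.
have sz' : (size p <= 3)%N by rewrite size_rcons in sz; lia.
have np' : nzpath_from i p.
  move: np; rewrite /nzpath_from /=; case: p {IH sz sz'} => //= y p.
  by rewrite rcons_path; case/andP=> -> /andP[->].
rewrite pact_rcons -(IH sz' np').
have [[q' [E ->]]|[]] := proj_act x (Sub (Bseq sz') np' : proj_basis i).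
  by congr proj_vec; do 2!apply: val_inj; rewrite E.
by rewrite [val _]/= np.
Qed.

Lemma stable_pact M (U : 'cV_(mdim M) -> Prop) p n : stable U -> U n -> U (pact p n).
Proof. by case=> _ _ _ UA; elim: p n => //= x p IH n Un; apply/IH/UA. Qed.

Lemma proj_generates i : generates (M := proj k i) [:: (i, proj_gen i)].
Proof.
split=> [p|U sU UG y]; first by rewrite inE => /eqP->; apply: proj_gen_idem.
rewrite [y]delta_sum; apply: (stable_sum sU) => q _; case: (sU) => _ _ UZ _; apply: UZ.
rewrite -/(proj_vec q) proj_vec_pact; apply: stable_pact => //.
exact: (UG _ (mem_head _ _)).
Qed.

Lemma hom_proj_ext N i (f g : 'M[k]_(mdim N, mdim (proj k i))) :
  is_hom f -> is_hom g -> f *m proj_gen i = g *m proj_gen i -> f = g.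
Proof.
move=> [_ fA] [_ gA] E; apply: delta_ext => q; rewrite -/(proj_vec q) proj_vec_pact.
elim/last_ind: (val (val q)) => [//|p x IH].
by rewrite pact_rcons !mulmxA fA gA -!mulmxA IH.
Qed.
End Modules.
Arguments generates {k} M G.
Arguments stable {k} M U.
Arguments stable_sum {k M U I s P F}.

(** * Enumeration of the nonzero paths *)

(** Explicit lists, unlike the enumeration of a finite type, let the paths be counted by
    evaluation. *)
Definition arrows : seq arrow :=
  [seq (i, b) | i <- [:: @Ordinal 3 0 isT; @Ordinal 3 1 isT; @Ordinal 3 2 isT],
                b <- [:: true; false]].

Fixpoint words (n : nat) : seq (seq arrow) :=
  if n is n'.+1 then [::] :: [seq x :: p | x <- arrows, p <- words n'] else [:: [::]].

Lemma mem_words n p : (size p <= n)%N -> p \in words n.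
Proof.
have ax x : x \in arrows by case: x => -[[|[|[|m]]] lm] [].
elim: n p => [|n IH] [|x p] // pn.
change (x :: p \in [::] :: [seq y :: q | y <- arrows, q <- words n]).
rewrite inE; apply/orP; right; apply: (allpairs_f cons); first exact: ax.
exact: IH.
Qed.

(** The dimension of [P_i] at the vertex [j]: the relations kill every change of colour, so one
    nonzero path of each colour leads from [i] to each lower vertex. *)
Definition npaths (i j : nat) : nat :=
  if i == j then 1 else if (j < i)%N then 2 else 0.

Lemma perm_proj_basis i :
  perm_eq [seq val (val q) | q <- enum (proj_basis i)]
          [seq p <- words 3 | nzpath_from i p].
Proof.
apply: uniq_perm.
- by rewrite map_inj_uniq ?enum_uniq // => p q E; do 2!apply: val_inj.
- by apply: filter_uniq; vm_compute.
move=> p; rewrite mem_filter; apply/mapP/andP => [[q _ ->]|[np _]].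
  by split; [apply: (valP q) | apply/mem_words/(valP (val q))].
have sz : (size p <= 3)%N.
  by rewrite -ltnS; apply: leq_ltn_trans (ltn_ord i); rewrite -(nzpath_size np) leq_addr.
by exists (Sub (Bseq sz) np); rewrite ?mem_enum.
Qed.

Lemma card_proj_basis i : #|proj_basis i| = i.*2.+1.
Proof.
rewrite cardE -(size_map (fun q => val (val q))) (perm_size (perm_proj_basis i)).
by case: i => -[|[|[|[|m]]]] lm //; vm_compute.
Qed.

Lemma card_proj_end (i j : vertex) :
  #|[pred q : proj_basis i | path_end i (val (val q)) == j]| = npaths i j.
Proof.
rewrite cardE /enum_mem size_filter.
transitivity (count (fun p => path_end i p == j) [seq p <- words 3 | nzpath_from i p]).
  by rewrite -(permP (perm_proj_basis i)) [RHS]count_map enumT; apply: eq_count.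
by case: i j => -[|[|[|[|m]]]] lm [] [|[|[|[|m']]]] lm' //; vm_compute.
Qed.

(** * Sums of projectives *)

Section Free.
Variable k : fieldType.
Implicit Types (M N L : lmodule4 k).

(** This coordinate projection factors as [B^T *m B] through the coordinates in [P], and [B *m B^T]
    is the identity. *)
Lemma rank_diag_pred (T : finType) (P : pred T) :
  \rank (diag_mx (\row_(t < #|T|) (P (enum_val t))%:R) : 'M[k]_#|T|) = #|P|.
Proof.
pose B : 'M[k]_(#|P|, #|T|) := \matrix_(i, j) (enum_val i == enum_val j)%:R.
set D := diag_mx _.
have DE : D = B^T *m B.
  apply/matrixP=> i j; rewrite !mxE.
  have [<-|ij] := eqVneq i j; last first.
    rewrite mulr0n big1 // => l _; rewrite !mxE.
    case: eqP => [->|]; last by rewrite mul0r.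
    by rewrite (inj_eq enum_val_inj) (negbTE ij) mulr0.
  rewrite mulr1n; have [Pi|nPi] := boolP (P (enum_val i)).
    rewrite (bigD1 (enum_rank_in Pi (enum_val i))) //= big1 => [|l li].
      by rewrite !mxE enum_rankK_in // eqxx mulr1 addr0.
    rewrite !mxE; case: eqP => [E|]; last by rewrite mul0r.
    by case/eqP: li; apply: enum_val_inj; rewrite enum_rankK_in.
  rewrite big1 // => l _; rewrite !mxE; case: eqP => [E|]; last by rewrite mul0r.
  by have := enum_valP l; rewrite E unfold_in (negbTE nPi).
have BB : B *m B^T = 1%:M.
  apply/matrixP=> i j; rewrite !mxE (bigD1 (enum_rank (enum_val i))) //=.
  rewrite big1 => [|l li].
    by rewrite !mxE !enum_rankK eqxx mul1r addr0 (inj_eq enum_val_inj) eq_sym.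
  rewrite !mxE; case: eqP => [E|]; last by rewrite mul0r.
  by rewrite E enum_valK eqxx in li.
apply/eqP; rewrite eqn_leq DE (leq_trans (mxrankM_maxr _ _)) ?rank_leq_row //=.
have E : B *m (B^T *m B) *m B^T = 1%:M by rewrite mulmxA BB mul1mx.
rewrite -{1}(mxrank1 k #|P|) -E.
by rewrite (leq_trans (mxrankM_maxl _ _)) // mxrankM_maxr.
Qed.

Lemma rank_proj (i j : vertex) : \rank (midem (proj k i) j) = npaths i j.
Proof. by rewrite -card_proj_end -rank_diag_pred. Qed.

(** Lists of vertices allow induction on the summands; [projsE] recovers [projs] from the list
    sorted by vertex. *)
Definition free_mod (s : seq vertex) : lmodule4 k := dsums [seq proj k i | i <- s].

Lemma rank_free s (j : vertex) :
  \rank (midem (free_mod s) j) = (\sum_(i <- s) npaths i j)%N.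
Proof.
elim: s => [|i s IH]; first by rewrite big_nil flatmx0 mxrank0.
by rewrite big_cons -IH -rank_proj rank_diag_block_mx.
Qed.

Lemma mdim_free s : mdim (free_mod s) = (\sum_(i <- s) (nat_of_ord i).*2.+1)%N.
Proof.
elim: s => [|i s IH]; first by rewrite big_nil.
by rewrite big_cons -IH -card_proj_basis.
Qed.

Definition vlist (a : vertex -> nat) : seq vertex :=
  flatten [seq nseq (a i) i | i <- enum 'I_4].

Lemma count_vlist a j : count_mem j (vlist a) = a j.
Proof.
rewrite /vlist count_flatten sumnE 2!big_map big_enum /= (bigD1 j) //= big1.
  by rewrite count_nseq /= eqxx mul1n addn0.
by move=> i /negbTE ij; rewrite count_nseq /= ij.
Qed.

Lemma perm_vlist s : perm_eq s (vlist (fun i => count_mem i s)).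
Proof. by apply/allP=> i _ /=; rewrite count_vlist. Qed.

Lemma projsE a : projs k a = free_mod (vlist a).
Proof.
rewrite /projs /free_mod /vlist map_flatten -map_comp; congr (dsums (flatten _)).
by apply: eq_map => i /=; rewrite map_nseq.
Qed.

Lemma surj_rinv m n (f : 'M[k]_(m, n)) : surj f -> exists g, f *m g = 1%:M.
Proof.
move=> fs; have /fin_all_exists[x Ex] : forall i : 'I_m, exists x : 'cV_n,
  f *m x = delta_mx i 0 by move=> i; apply: fs.
exists (\matrix_(i, j) x j i 0); apply/matrixP=> i j.
have /colP/(_ i) := Ex j; rewrite !mxE eqxx andbT => <-.
by apply: eq_bigr => l _; rewrite mxE.
Qed.

Lemma surj_inv m n (f : 'M[k]_(m, n)) : m = n -> surj f ->
  exists g, f *m g = 1%:M /\ g *m f = 1%:M.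
Proof.
move=> mn; case: n / mn f => f /surj_rinv[g fg].
by exists g; split=> //; apply: mulmx1C.
Qed.

Lemma hom_inv M N (f : 'M[k]_(mdim N, mdim M)) (g : 'M[k]_(mdim M, mdim N)) :
  is_hom f -> f *m g = 1%:M -> g *m f = 1%:M -> is_hom g.
Proof.
move=> [f1 f2] fg gf.
by split=> i; rewrite -[LHS]mulmx1 -fg mulmxA -(mulmxA g) -(f1, f2) !mulmxA gf mul1mx.
Qed.

Lemma hom_row M M' N (f : 'M[k]_(mdim N, mdim M)) (g : 'M[k]_(mdim N, mdim M')) :
  is_hom f -> is_hom g -> @is_hom k (dsum M M') N (row_mx f g).
Proof.
move=> [f1 f2] [g1 g2]; split=> i /=.
  by rewrite mul_row_block mul_mx_row !mulmx0 addr0 add0r f1 g1.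
by rewrite mul_row_block mul_mx_row !mulmx0 addr0 add0r f2 g2.
Qed.

Lemma row_hom M M' N (f : 'M[k]_(mdim N, mdim M)) (g : 'M[k]_(mdim N, mdim M')) :
  @is_hom k (dsum M M') N (row_mx f g) -> is_hom f /\ is_hom g.
Proof.
move=> [h1 h2]; split; split=> i;
  [have := h1 i | have := h2 i | have := h1 i | have := h2 i] => /=;
  by rewrite mul_row_block mul_mx_row !mulmx0 addr0 add0r => /eq_row_mx[].
Qed.

Lemma hom_from0 N (f : 'M[k]_(mdim N, 0)) : @is_hom k (zero_mod k) N f.
Proof. by split=> i; apply/matrixP=> ? []. Qed.

(** Projectivity: it suffices to lift the generator of each summand. *)
Lemma free_lift s N N' (g : 'M[k]_(mdim N, mdim N'))
    (u : 'M[k]_(mdim N, mdim (free_mod s))) :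
  is_hom g -> is_hom u ->
  (forall y : 'cV_(mdim (free_mod s)), exists x : 'cV_(mdim N'), g *m x = u *m y) ->
  exists h : 'M[k]_(mdim N', mdim (free_mod s)), is_hom h /\ g *m h = u.
Proof.
move=> hg; elim: s u => [|i s IH] u.
  by exists 0; split; [apply: hom_from0 | apply/matrixP=> ? []].
pose n1 := mdim (proj k i); pose n2 := mdim (free_mod s).
suff H (u1 : 'M_(mdim N, n1)) (u2 : 'M_(mdim N, n2)) :
    @is_hom k (free_mod (i :: s)) N (row_mx u1 u2) ->
    (forall y : 'cV_(n1 + n2), exists x : 'cV_(mdim N'), g *m x = row_mx u1 u2 *m y) ->
    exists h : 'M_(mdim N', n1 + n2),
      @is_hom k (free_mod (i :: s)) N' h /\ g *m h = row_mx u1 u2.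
  by rewrite -[u](@hsubmxK _ _ n1 n2); apply: H.
move=> /row_hom[hu1 hu2] gu.
have [x Ex] := gu (col_mx (proj_gen k i) 0).
rewrite mul_row_col mulmx0 addr0 in Ex.
have [h2 [hh2 E2]] : exists h, @is_hom k (free_mod s) N' h /\ g *m h = u2.
  apply: IH => // y; have [z Ez] := gu (col_mx 0 y).
  by exists z; rewrite Ez mul_row_col mulmx0 add0r.
(* An arbitrary preimage of the generator is first projected to the vertex [i], so that it defines a
   morphism from [P_i]. *)
have Hx : midem N' i *m (midem N' i *m x) = midem N' i *m x by rewrite mulmxA midem_id.
have hh1 := proj_hom_hom Hx.
exists (row_mx (proj_hom i (midem N' i *m x)) h2); split; first exact: hom_row.
rewrite mul_mx_row E2; congr row_mx; apply: hom_proj_ext => //; first exact: hom_comp.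
rewrite -mulmxA proj_homE /= mulmxA hg.1 -mulmxA Ex mulmxA -hu1.1 -mulmxA.
by rewrite proj_gen_idem.
Qed.

Lemma free_hom N (G : seq (vertex * 'cV[k]_(mdim N))) :
  (forall p, p \in G -> midem N p.1 *m p.2 = p.2) ->
  exists h : 'M[k]_(mdim N, mdim (free_mod (map fst G))), is_hom h /\
    forall p, p \in G -> exists x : 'cV_(mdim (free_mod (map fst G))), h *m x = p.2.
Proof.
elim: G => [|[i n] G IH] HG.
  by exists (0 : 'M_(_, 0)); split; [apply: hom_from0|].
have [|h [hh Eh]] := IH; first by move=> p pG; apply: HG; rewrite inE pG orbT.
have Hn : midem N i *m n = n by apply: (HG (i, n)); rewrite mem_head.
exists (row_mx (proj_hom i n) h); split.
  exact: (@hom_row (proj k i) (free_mod (map fst G))) (proj_hom_hom Hn) hh.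
move=> p; rewrite inE => /orP[/eqP->|/Eh[x Ex]].
  by exists (col_mx (proj_gen k i) 0); rewrite mul_row_col mulmx0 addr0 proj_homE.
by exists (col_mx 0 x); rewrite mul_row_col mulmx0 add0r.
Qed.

(* N is the direct sum of the projectives at the vertices of s: it is generated by
   elements at these vertices and has the right dimension. *)
Definition is_free N (s : seq vertex) : Prop :=
  mdim N = (\sum_(i <- s) (nat_of_ord i).*2.+1)%N /\
  exists G, generates N G /\ map fst G = s.

(** The generators give a surjection from a sum of projectives, and equality of dimensions makes it
    bijective. *)
Lemma free_projs N s : is_free N s ->
  let P := projs k (fun i => count_mem i s) in
  exists (f : 'M[k]_(mdim N, mdim P)) (g : 'M[k]_(mdim P, mdim N)),
    [/\ is_hom f, is_hom g, f *m g = 1%:M & g *m f = 1%:M].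
Proof.
case=> dN [G [[Gv Ggen] Gs]]; rewrite projsE.
(* The generators are sorted by vertex, to match the order of the summands in [projs]. *)
pose G' := flatten [seq [seq p <- G | p.1 == i] | i <- enum 'I_4].
have memG p : (p \in G') = (p \in G).
  apply/flattenP/idP => [[_ /mapP[i _ ->]]|pG]; first by rewrite mem_filter => /andP[].
  exists [seq q <- G | q.1 == p.1]; last by rewrite mem_filter eqxx.
  by apply/mapP; exists p.1; rewrite ?mem_enum.
have G's : map fst G' = vlist (fun i => count_mem i s).
  rewrite map_flatten -map_comp; congr flatten; apply: eq_map => i /=.
  rewrite -Gs; elim: (G) => //= p G0 IH.
  by case: eqP => /= [->|_]; rewrite IH.
have [h [hh hG]] : exists h : 'M[k]_(mdim N, mdim (free_mod (map fst G'))), is_hom h /\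
    forall p, p \in G' -> exists x : 'cV_(mdim (free_mod (map fst G'))), h *m x = p.2.
  by apply: free_hom => p; rewrite memG; apply: Gv.
have hs : surj h.
  by move=> y; apply: (Ggen _ (stable_im hh)) => p pG; apply: hG; rewrite memG.
have dE : mdim N = mdim (free_mod (vlist (fun i => count_mem i s))).
  by rewrite dN mdim_free; apply/perm_big/perm_vlist.
move: h hh hG hs dE; rewrite G's => h hh _ hs dE.
have [g [hg gh]] := surj_inv dE hs.
by exists h, g; split=> //; apply: hom_inv hg gh.
Qed.
End Free.

(** * g-vectors *)

Section Gvectors.
Variable k : fieldType.
Implicit Types (X Y M N L P : lmodule4 k).

Lemma surj_hom_rank M N (h : 'M[k]_(mdim N, mdim M)) j : is_hom h -> surj h ->
  (\rank (midem N j) <= \rank (midem M j))%N.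
Proof.
move=> hh /surj_rinv[g hg].
rewrite -[midem N j]mulmx1 -hg mulmxA -hh.1.
by rewrite (leq_trans (mxrankM_maxl _ _)) // mxrankM_maxr.
Qed.

Lemma rank_projs a j :
  \rank (midem (projs k a) j) = (\sum_(i : 'I_4) a i * npaths i j)%N.
Proof.
rewrite projsE rank_free /vlist big_flatten /= big_map big_enum /=.
by apply: eq_bigr => i _; rewrite big_nseq iter_addn_0 mulnC.
Qed.

(** The dimensions at the four vertices are a unitriangular system in the multiplicities. *)
Lemma projs_inj a a' :
  (forall j, \rank (midem (projs k a) j) = \rank (midem (projs k a') j)) -> a =1 a'.
Proof.
move=> E; have := E (inord 0); have := E (inord 1); have := E (inord 2).
have := E (inord 3); rewrite !rank_projs !big_ord_recl !big_ord0 /= !inordK //.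
rewrite /npaths /= /bump /= => e3 e2 e1 e0 j.
have : [|| j == ord0, j == lift ord0 ord0, j == lift ord0 (lift ord0 ord0)
    | j == lift ord0 (lift ord0 (lift ord0 ord0))].
  by case: j => -[|[|[|[|m]]]].
case/or4P=> /eqP->; lia.
Qed.

(** The morphism [p] lifts through [p'] to [h0], and [h0] restricts to the kernels and lifts to
    [h1]; both are surjective because [p'] and [f'] are essential. By symmetry, two minimal
    presentations have the same multiplicities. *)
Lemma presentation_le X a b f p a' b' f' p' :
  @min_presentation k (projs k b) (projs k a) X f p ->
  @min_presentation k (projs k b') (projs k a') X f' p' ->
  forall j, (\rank (midem (projs k a') j) <= \rank (midem (projs k a) j))%N /\
            (\rank (midem (projs k b') j) <= \rank (midem (projs k b) j))%N.
Proof.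
move=> [[hf hp] ps pf _ _] [[hf' hp'] ps' pf' ep' ef'] j.
have [h0 [hh0 E0]] : exists h : 'M_(mdim (projs k a'), mdim (projs k a)),
    is_hom h /\ p' *m h = p.
  move: f p hf hp ps pf; rewrite projsE => f p hf hp ps pf.
  by apply: free_lift => // y; apply: ps'.
have s0 : surj h0.
  apply: ep' => // y; have [x Ex] := ps (p' *m y).
  by exists x; rewrite mulmxA E0.
have [h1 [hh1 E1]] : exists h : 'M_(mdim (projs k b'), mdim (projs k b)),
    is_hom h /\ f' *m h = h0 *m f.
  move: f hf pf; rewrite (projsE k b) => f hf pf.
  apply: free_lift => //; first exact: hom_comp.
  move=> y; apply/pf'; rewrite -mulmxA mulmxA E0; apply/pf.
  by exists y.
have s1 : surj h1.
  apply: ef' => // y; have [z Ez] := s0 (f' *m y).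
  have /pf[w Ew] : p *m z = 0.
    by rewrite -E0 -mulmxA Ez; apply/pf'; exists y.
  by exists w; rewrite mulmxA E1 -mulmxA Ew.
by split; [apply: surj_hom_rank s0 | apply: surj_hom_rank s1].
Qed.

Lemma gvector_unique X g g' : is_gvector X g -> is_gvector X g' -> g = g'.
Proof.
move=> [a [b [f [p [mp gE]]]]] [a' [b' [f' [p' [mp' gE']]]]].
have le := presentation_le mp mp'; have ge := presentation_le mp' mp.
have ea : a =1 a'.
  by apply: projs_inj => j; apply/eqP; rewrite eqn_leq (le j).1 (ge j).1.
have eb : b =1 b'.
  by apply: projs_inj => j; apply/eqP; rewrite eqn_leq (le j).2 (ge j).2.
by apply: eq_from_tnth => i; rewrite gE gE' ea eb.
Qed.

(** A minimal projective resolution of length one: [f] is injective and the last clause puts its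
    image in the radical of [P0]. The projectives are given only up to isomorphism, so that [P0] may
    be built as an extension. *)
Definition resolved X (s0 s1 : seq vertex) : Prop :=
  exists P0 P1 (f : 'M[k]_(mdim P0, mdim P1)) (p : 'M[k]_(mdim X, mdim P0)),
  [/\ is_free P0 s0 /\ is_free P1 s1, is_hom f /\ is_hom p,
      (forall y : 'cV_(mdim P1), f *m y = 0 -> y = 0) /\ surj p,
      forall x : 'cV_(mdim P0), p *m x = 0 <-> exists y : 'cV_(mdim P1), f *m y = x
    & forall y : 'cV_(mdim P1), exists r : arrow -> 'cV_(mdim P0),
        f *m y = \sum_x mact P0 x *m r x].

(** The resolution is transported to sums of standard projectives, where the two essentiality
    conditions are verified. *)
Lemma resolved_gvector X s0 s1 (g : 4.-tuple int) : resolved X s0 s1 ->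
  (forall i, tnth g i = (count_mem i s0)%:Z - (count_mem i s1)%:Z) -> is_gvector X g.
Proof.
move=> [P0 [P1 [f [p [[F0 F1] [hf hp] [fi ps] ex fr]]]]] gE.
have [u0 [v0 [hu0 hv0 uv0 vu0]]] := free_projs F0.
have [u1 [v1 [hu1 hv1 uv1 vu1]]] := free_projs F1.
exists (fun i => count_mem i s0), (fun i => count_mem i s1).
exists (v0 *m f *m u1), (p *m u0); split=> //.
have ex' (x : 'cV_(mdim (projs k (fun i => count_mem i s0)))) :
    p *m u0 *m x = 0 <-> exists y : 'cV_(mdim (projs k (fun i => count_mem i s1))), v0 *m f *m u1 *m y = x.
  rewrite -[p *m u0 *m x]mulmxA; split=> [/ex[y E]|[y <-]].
    exists (v1 *m y); rewrite -!mulmxA (mulmxA u1) uv1 mul1mx E.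
    by rewrite mulmxA vu0 mul1mx.
  by apply/ex; exists (u1 *m y); rewrite !mulmxA uv0 mul1mx.
split.
- by split; do ?apply: hom_comp.
- move=> y; have [x <-] := ps y; exists (v0 *m x).
  by rewrite -mulmxA (mulmxA u0) uv0 mul1mx.
- exact: ex'.
(* A vector with the same image under the cover differs from a value of [h] by an element of the
   kernel, hence of the radical. *)
- move=> L h hh H; apply: nakayama => // y; have [x Ex] := H y.
  have /ex'[w Ew] : p *m u0 *m (y - h *m x) = 0 by rewrite mulmxBr Ex subrr.
  have [r Er] := fr (u1 *m w).
  exists x, (fun a => v0 *m r a); apply/eqP; rewrite addrC -subr_eq -Ew; apply/eqP.
  rewrite -!mulmxA Er mulmx_sumr; apply: eq_bigr => a _.
  by rewrite !mulmxA hv0.2.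
(* The other map is injective, so equality of images lifts to equality. *)
move=> L h hh H y; have [x Ex] := H y; exists x; apply/eqP.
rewrite -subr_eq0; apply/eqP; rewrite -[LHS]mul1mx -vu1 -mulmxA.
rewrite [X in v1 *m X]fi ?mulmx0 //.
rewrite -[LHS]mul1mx -uv0 -mulmxA [X in u0 *m X](_ : _ = 0) ?mulmx0 //.
by rewrite mulmxA mulmxA mulmxBr Ex subrr.
Qed.

Lemma is_free_dsum M N s t : is_free M s -> is_free N t -> is_free (dsum M N) (s ++ t).
Proof.
move=> [dM [G [[Gv Gg] Gs]]] [dN [H [[Hv Hg] Hs]]].
split; first by rewrite big_cat -dM -dN.
exists ([seq (p.1, col_mx p.2 0) | p <- G] ++ [seq (p.1, col_mx 0 p.2) | p <- H]).
split; last by rewrite map_cat -!map_comp Gs Hs.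
split=> [p|U [U0 UD UZ UA] UG y].
  rewrite mem_cat => /orP[] /mapP[q qG ->] /=.
    by rewrite mul_block_col !mulmx0 !mul0mx !addr0 Gv.
  by rewrite mul_block_col !mulmx0 !mul0mx !add0r Hv.
have UM x : U (col_mx x 0).
  apply: (Gg (fun x => U (col_mx x 0))) => [|p pG].
    split=> [|x' y' Ux Uy|c x' Ux|a x' Ux]; first by rewrite col_mx0.
    - by rewrite -[0]addr0 -add_col_mx; apply: UD.
    - by rewrite -[0](scaler0 _ c) -scale_col_mx; apply: UZ.
    - have := UA a _ Ux; rewrite /= mul_block_col.
      by rewrite !mulmx0 !mul0mx !addr0.
  by apply: (UG (p.1, col_mx p.2 0)); rewrite mem_cat map_f.
have UN x : U (col_mx 0 x).
  apply: (Hg (fun x => U (col_mx 0 x))) => [|p pG].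
    split=> [|x' y' Ux Uy|c x' Ux|a x' Ux]; first by rewrite col_mx0.
    - by rewrite -[0]addr0 -add_col_mx; apply: UD.
    - by rewrite -[0](scaler0 _ c) -scale_col_mx; apply: UZ.
    - have := UA a _ Ux; rewrite /= mul_block_col.
      by rewrite !mulmx0 !mul0mx !add0r.
  apply: (UG (p.1, col_mx 0 p.2)); rewrite mem_cat; apply/orP; right.
  exact: (map_f (fun q : vertex * 'cV_(mdim N) => (q.1, col_mx (0 : 'cV_(mdim M)) q.2))).
rewrite -[y](@vsubmxK _ (mdim M) (mdim N)) -[usubmx _]addr0 -[dsubmx _]add0r -add_col_mx.
exact: UD.
Qed.

Lemma is_free_nil : is_free (zero_mod k) [::].
Proof.
split; first by rewrite big_nil.
by exists [::]; split=> //; split=> // U [U0 _ _ _] _ y; rewrite flatmx0.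
Qed.

Lemma is_free_proj i : is_free (proj k i) [:: i].
Proof.
split; first by rewrite big_seq1 -card_proj_basis.
by exists [:: (i, proj_gen k i)]; split=> //; apply: proj_generates.
Qed.

Lemma is_free_free s : is_free (free_mod k s) s.
Proof.
elim: s => [|i s IH]; first exact: is_free_nil.
by rewrite -cat1s; apply: (is_free_dsum (is_free_proj i) IH).
Qed.

Lemma resolved_zero : resolved (zero_mod k) [::] [::].
Proof.
exists (zero_mod k), (zero_mod k), 0, 0.
have F := is_free_nil; split=> //.
- by split=> [y _|y]; [|exists 0]; apply/colP=> -[].
- by move=> x; split=> _; [exists 0|]; apply/colP=> -[].
- by move=> y; exists (fun=> 0); apply/colP=> -[].
Qed.

Lemma hom_block M M' N N' (f : 'M[k]_(mdim M, mdim M')) (g : 'M[k]_(mdim N, mdim N')) :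
  is_hom f -> is_hom g -> @is_hom k (dsum M' N') (dsum M N) (block_mx f 0 0 g).
Proof.
move=> [f1 f2] [g1 g2].
by split=> i; rewrite /= !mulmx_block !mulmx0 !mul0mx !addr0 !add0r ?f1 ?g1 ?f2 ?g2.
Qed.

Lemma mul_diag_col m n p q (A : 'M[k]_(m, n)) (B : 'M[k]_(p, q)) (x : 'cV_n) (y : 'cV_q) :
  block_mx A 0 0 B *m col_mx x y = col_mx (A *m x) (B *m y).
Proof. by rewrite mul_block_col !mul0mx addr0 add0r. Qed.

Lemma col_mx_inj0 m n (x : 'cV[k]_m) (y : 'cV[k]_n) : col_mx x y = 0 -> x = 0 /\ y = 0.
Proof. by rewrite -col_mx0 => /eq_col_mx. Qed.

Lemma resolved_dsum X Y s0 s1 t0 t1 : resolved X s0 s1 -> resolved Y t0 t1 ->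
  resolved (dsum X Y) (s0 ++ t0) (s1 ++ t1).
Proof.
move=> [P0 [P1 [f [p [[F0 F1] [hf hp] [fi ps] ex fr]]]]].
move=> [Q0 [Q1 [g [q [[G0 G1] [hg hq] [gi qs] gx gr]]]]].
have cE m n (x : 'cV[k]_(m + n)) : exists y z, x = col_mx y z.
  by exists (usubmx x), (dsubmx x); rewrite vsubmxK.
exists (dsum P0 Q0), (dsum P1 Q1), (block_mx f 0 0 g), (block_mx p 0 0 q).
split.
- by split; apply: is_free_dsum.
- by split; apply: hom_block.
- split=> [y|y].
    have [y1 [y2 ->]] := cE _ _ y; rewrite mul_diag_col => /col_mx_inj0[].
    by move=> /fi-> /gi->; rewrite col_mx0.
  have [y1 [y2 ->]] := cE _ _ y; have [x1 E1] := ps y1; have [x2 E2] := qs y2.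
  by exists (col_mx x1 x2); rewrite mul_diag_col E1 E2.
- move=> x; have [x1 [x2 ->]] := cE _ _ x; rewrite mul_diag_col; split.
    move=> /col_mx_inj0[/ex[y1 E1] /gx[y2 E2]].
    by exists (col_mx y1 y2); rewrite mul_diag_col E1 E2.
  move=> [y]; have [y1 [y2 ->]] := cE _ _ y; rewrite mul_diag_col => /eq_col_mx[E1 E2].
  have -> : p *m x1 = 0 by apply/ex; exists y1.
  have -> : q *m x2 = 0 by apply/gx; exists y2.
  by rewrite col_mx0.
- move=> y; have [y1 [y2 ->]] := cE _ _ y; have [r1 E1] := fr y1; have [r2 E2] := gr y2.
  exists (fun a => col_mx (r1 a) (r2 a)); rewrite mul_diag_col E1 E2.
  under [RHS]eq_bigr do rewrite mul_diag_col.
  elim/big_ind3: _ => // [|A a B b C c <- <-]; first by rewrite col_mx0.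
  by rewrite add_col_mx.
Qed.
End Gvectors.

(** * Bands *)

Section BandWalk.
Variable z : band.
Local Notation r := (size (bwalk z)).
Implicit Types t p q : 'I_r.

Definition up t : bool := (bletter t).2.
Definition bheight t : nat := bvertex t.
(* The colour of the arrows along which the walk descends. *)
Definition color t : bool := (bletter t).1.2 (+) (bletter t).2.

Lemma band_size : (0 < r)%N.
Proof. by case: (bwalkP z) => _; case: (bwalk z). Qed.

Lemma bvertexS t : bvertex (ordS t) = ltgt (bletter t).
Proof. by have /and4P[/eqP-> _ _ _] := band_step t. Qed.

(** Between two letters in the same direction the relations forbid a change of colour; at a turn, a
    letter of the same colour would be the inverse of the preceding one. Adding the direction to the
    colour of the arrow gives an invariant. *)
Lemma colorS t : color (ordS t) = color t.
Proof.
have /and4P[/eqP E1 /eqP E2 E3 E4] := band_step t; rewrite /color.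
move: E1 E2 E3 E4; move: (bletter t) (bletter (ordS t)) => [[i b] d] [[j b'] d'].
rewrite /lrel4 /rel4 /linv /ltgt /lsrc /src /tgt /=.
have S_inj := @lift_inj 4 ord0.
have T_inj : injective (widen_ord (leqnSn 3)).
  by move=> u v /(f_equal val) /= E; apply: val_inj.
case: d d' => [] [] /= E1 E2; rewrite ?E1 ?eqxx /= ?andbT ?andbF //.
- by move=> _; case: b b' {E1 E2} => [] [].
- by move=> _ _; case: b b' E2 => [] [] // []; rewrite (S_inj _ _ E1).
- by move=> _ _; case: b b' E2 => [] [] // []; rewrite (T_inj _ _ E1).
- by move=> /negP; case: b b' {E1 E2} => [] [].
Qed.

Lemma color_const p q : color p = color q.
Proof.
suff E n (ln : (n < r)%N) : color (Ordinal ln) = color (Ordinal band_size).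
  by case: p q => [n ln] [m lm]; rewrite !E.
elim: n ln => [|n IH] ln; first by congr color; apply: val_inj.
rewrite -(IH (ltnW ln)) -(colorS (Ordinal (ltnW ln))); congr color; apply: val_inj => /=.
by rewrite modn_small.
Qed.

Definition bcolor : bool := color (Ordinal band_size).

Lemma bletter_color t : (bletter t).1.2 = bcolor (+) up t.
Proof. by rewrite /bcolor -(color_const t) /color -addbA addbb addbF. Qed.

Lemma bletter_index t :
  (bletter t).1.1 = (if up t then bheight t else bheight (ordS t)) :> nat.
Proof.
rewrite /bheight bvertexS /bvertex /ltgt /lsrc /up.
by case: (bletter t).2.
Qed.

Lemma up_height t : bheight (ordS t) =
  if up t then (bheight t).+1 else (bheight t).-1.
Proof.
rewrite /bheight bvertexS /bvertex /ltgt /lsrc /up /src /tgt.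
by case: (bletter t).2.
Qed.

Lemma down_height_gt0 t : ~~ up t -> (0 < bheight t)%N.
Proof. by rewrite /bheight /bvertex /lsrc /up /src; case: (bletter t).2. Qed.

Lemma up_height_lt3 t : up t -> (bheight t < 3)%N.
Proof.
rewrite /bheight /bvertex /lsrc /up /tgt; case: (bletter t).2 => //= _.
Qed.

Lemma bheight_lt4 t : (bheight t < 4)%N. Proof. exact: ltn_ord. Qed.

(** The basis vector at [t] sits between the letters [ord_pred t] and [t]; it is at the top of the
    module at a peak and in the socle at a deep. *)
Definition peak t : bool := up (ord_pred t) && ~~ up t.
Definition deep t : bool := ~~ up (ord_pred t) && up t.

Lemma deepS t : deep (ordS t) = ~~ up t && up (ordS t).
Proof. by rewrite /deep ordSK. Qed.

Lemma sum_pred (R : nmodType) (F : 'I_r -> 'I_r -> R) :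
  \sum_t F (ord_pred t) t = \sum_t F t (ordS t).
Proof.
rewrite (reindex_inj (bij_inj (ordS_bij r))) /=.
by apply: eq_bigr => t _; rewrite ordSK.
Qed.

(** The indicator of the peaks minus that of the deeps is the difference of [up] at [ord_pred t] and
    at [t]; summation by parts does the rest. *)
Lemma peak_deep_sum (F : 'I_r -> int) :
  \sum_(t | peak t) F t - \sum_(t | deep t) F t = \sum_(t | up t) (F (ordS t) - F t).
Proof.
rewrite big_mkcond [X in _ - X]big_mkcond [RHS]big_mkcond /= -sumrB.
have -> : \sum_t ((if peak t then F t else 0) - (if deep t then F t else 0)) =
    \sum_t ((if up (ord_pred t) then F t else 0) - (if up t then F t else 0)).
  by apply: eq_bigr => t _; rewrite /peak /deep; case: (up _) (up t) => [] [] /=; ring.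
rewrite sumrB (sum_pred (fun s t => if up s then F t else 0)) -sumrB.
by apply: eq_bigr => t _; case: ifP => _; ring.
Qed.

(** A closed walk climbs as often as it descends. *)
Lemma up_count : (#|[pred t | up t]|.*2 = r)%N.
Proof.
have : \sum_t ((bheight (ordS t))%:Z - (bheight t)%:Z) = 0.
  by rewrite sumrB (sum_pred (fun s t => (bheight t)%:Z)) subrr.
have -> : \sum_t ((bheight (ordS t))%:Z - (bheight t)%:Z) =
    \sum_t ((up t : nat)%:Z *+ 2 - 1).
  apply: eq_bigr => t _; rewrite up_height; have := @down_height_gt0 t.
  by case: (up t) => /=; lia.
rewrite sumrB sumr_const card_ord sumrMnl.
have -> : \sum_t (up t : nat)%:Z = #|[pred t | up t]|%:Z.
  rewrite -[RHS]natz -sum1_card natr_sum [RHS]big_mkcond /=.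
  by apply: eq_bigr => t _; rewrite inE; case: (up t).
lia.
Qed.

End BandWalk.

(** * Extensions and the resolution of a band module *)

Section Extension.
Variables (k : fieldType) (M N : lmodule4 k) (d : arrow -> 'M[k]_(mdim M, mdim N)).
Hypothesis d_idem : forall x, midem M (tgt x) *m d x *m midem N (src x) = d x.
Hypothesis d_rel : forall x y, rel4 x y -> mact M x *m d y + d x *m mact N y = 0.

(** The hypotheses make [d] a derivation vanishing on the relations, that is, a cocycle for an
    extension with submodule [M] and quotient [N]. *)
Lemma ext_axiom :
  lambda4_axiom (fun i => block_mx (midem M i) 0 0 (midem N i))
                (fun x => block_mx (mact M x) (d x) 0 (mact N x)).
Proof.
case: (maxiom (dsum M N)) => E1 E2 _ _.
case: (maxiom M) => _ _ M3 M4; case: (maxiom N) => _ _ N3 N4.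
split=> [||x|x y xy] //.
  by rewrite !mulmx_block !(mulmx0, mul0mx, addr0, add0r) M3 N3 d_idem.
by rewrite mulmx_block !(mulmx0, mul0mx, addr0, add0r) M4 // N4 // d_rel // block_mx0.
Qed.

Definition ext_mod : lmodule4 k := Lmodule4 ext_axiom.
End Extension.

Definition bvec (k : fieldType) (z : band) (l : k) (t : 'I_(size (bwalk z))) :
  'cV[k]_(mdim (band_mod z l)) := delta_mx (enum_rank t) 0.

Lemma bscalar_neq0  (k : fieldType) (z : band) (l : k) (t : 'I_(size (bwalk z))) :
  l != 0 -> bscalar l t != 0.
Proof. by rewrite /bscalar => l0; case: ifP => // _; apply: oner_neq0. Qed.

Section BandResolution.
Variables (k : fieldType) (z : band) (lambda : k).
Hypothesis lambda0 : lambda != 0.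
Local Notation r := (size (bwalk z)).
Local Notation X := (band_mod z lambda).
Implicit Types t p q : 'I_r.
Local Notation eps := (bvec lambda).
Local Notation mu := (bscalar lambda).

Lemma band_act x t : mact X x *m eps t =
  if bletter t == (x, false) then mu t *: eps (ordS t)
  else if bletter (ord_pred t) == (x, true) then (mu (ord_pred t))^-1 *: eps (ord_pred t)
  else 0.
Proof.
rewrite /bvec basis_act; case: ifP => lt; last case: ifP => lp.
- rewrite (bigD1 (ordS t)) //= big1 ?addr0 => [|q /negbTE qt].
    by rewrite /band_coef lt eqxx.
  rewrite /band_coef lt qt /=; case: ifP => [/andP[/eqP lq /eqP tq]|_]; last by rewrite scale0r.
  have /and4P[_ /eqP[]] := band_step q.
  by rewrite -tq (eqP lt) lq.
- rewrite (bigD1 (ord_pred t)) //= big1 ?addr0 => [|q /eqP qt].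
    by rewrite /band_coef lt lp ord_predK eqxx.
  rewrite /band_coef lt /=; case: ifP => [/andP[_ /eqP tq]|_]; last by rewrite scale0r.
  by case: qt; rewrite tq ordSK.
rewrite big1 // => q _; rewrite /band_coef lt /=.
case: ifP => [/andP[lq /eqP tq]|_]; last by rewrite scale0r.
by rewrite tq ordSK lq in lp.
Qed.

Lemma band_idem i t : midem X i *m eps t = (bvertex t == i)%:R *: eps t.
Proof. by rewrite /bvec basis_idem. Qed.

Definition tops : seq vertex := [seq bvertex t | t <- enum 'I_r & peak t].
Definition bots : seq vertex := [seq bvertex t | t <- enum 'I_r & deep t].

Variables (w : 'I_r -> 'cV[k]_(mdim (free_mod k bots))).
Hypothesis w_idem : forall t, deep t -> midem (free_mod k bots) (bvertex t) *m w t = w t.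
Hypothesis w_gen : forall U, stable (free_mod k bots) U ->
  (forall t, deep t -> U (w t)) -> forall y, U y.
Local Notation P1 := (free_mod k bots).

(* In the extension, the two arrows into a deep t have images eps t (up to scalars)
   and eps t + w t, so that w t measures the difference between the two slopes. *)
Definition ext_col x t : 'cV[k]_(mdim P1) :=
  (if (bletter t == (x, false)) && deep (ordS t) then w (ordS t) else 0) -
  (if deep t && (x.2 != bcolor z) then (mu (ord_pred t))^-1 *: (mact P1 x *m w t) else 0).

Definition ext_d x : 'M[k]_(mdim P1, mdim X) :=
  \matrix_(a, b) ext_col x (enum_val b) a 0.

Lemma ext_dE x t : ext_d x *m eps t = ext_col x t.
Proof. by rewrite -colE; apply/colP=> a; rewrite !mxE enum_rankK. Qed.

Lemma letter_down t x : bletter t = (x, false) ->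
  [/\ ~~ up t, x.2 = bcolor z, bvertex t = src x & bvertex (ordS t) = tgt x].
Proof.
move=> E; have := bletter_color t; rewrite bvertexS /bvertex /up E /= addbF => ->.
by [].
Qed.

Lemma letter_up t x : bletter t = (x, true) ->
  [/\ up t, x.2 != bcolor z, bvertex t = tgt x & bvertex (ordS t) = src x].
Proof.
move=> E; have := bletter_color t; rewrite bvertexS /bvertex /up E /= addbT => ->.
by split=> //; case: (bcolor z).
Qed.

Lemma ext_d_idem x : midem P1 (tgt x) *m ext_d x *m midem X (src x) = ext_d x.
Proof.
apply: delta_ext => t; rewrite -/(eps t) -!mulmxA band_idem -!scalemxAr ext_dE.
rewrite /ext_col mulmxBr scalerBr; congr (_ - _); case: ifP; rewrite ?mulmx0 ?scaler0 //.
  move=> /andP[/eqP/letter_down[_ _ -> tS] dS].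
  by rewrite eqxx scale1r -tS w_idem.
move=> /andP[dt _]; rewrite -scalemxAr mulmxA mact_tgt.
have [|ne] := eqVneq; first by rewrite scale1r.
rewrite scale0r -(w_idem dt) mulmxA mact_midem0 ?mul0mx ?scaler0 //.
by rewrite eq_sym.
Qed.

(** The only interesting case descends into a deep by [y] and continues by [x] of the other colour:
    there [x] applied to [w] is cancelled by the second term of [ext_col], which is chosen for this
    purpose. *)
Lemma ext_d_rel x y : rel4 x y -> mact P1 x *m ext_d y + ext_d x *m mact X y = 0.
Proof.
move=> xy; have xyc : x.2 != y.2 by case/andP: xy.
apply: delta_ext => t; rewrite -/(eps t) mul0mx mulmxDl -!mulmxA ext_dE band_act.
have [yc|yc] := eqVneq y.2 (bcolor z).
  rewrite /(ext_col y) yc eqxx andbF subr0.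
  have [lt|lt] := eqVneq (bletter t) (y, false); last first.
    case: eqP => [/letter_up[_]|_]; first by rewrite yc eqxx.
    by rewrite !mulmx0 addr0.
  rewrite /= -scalemxAr ext_dE /ext_col ordSK -yc xyc andbT.
  have [/andP[_ uS]|_] := boolP (deep (ordS t)); last first.
    case: eqP => [/letter_down[_ xc]|_]; first by rewrite xc -yc eqxx in xyc.
    by rewrite /= subr0 scaler0 mulmx0 addr0.
  case: eqP => [/letter_down[/negP[]]//|_] /=.
  by rewrite sub0r scalerN scalerA mulfV ?scale1r ?subrr // bscalar_neq0.
rewrite /(ext_col y); case: eqP => [/letter_down[_ E]|_]; first by rewrite E eqxx in yc.
rewrite yc andbT /= sub0r mulmxN.
have -> : mact P1 x *m (if deep t then (mu (ord_pred t))^-1 *: (mact P1 y *m w t) else 0) = 0.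
  case: ifP => _; last by rewrite mulmx0.
  rewrite -scalemxAr mulmxA; case: (maxiom P1) => _ _ _ -> //.
  by rewrite mul0mx scaler0.
rewrite oppr0 add0r; case: eqP => [lp|_]; last by rewrite mulmx0.
rewrite -scalemxAr ext_dE /ext_col; have [up_p _ _ _] := letter_up lp.
case: eqP => [/letter_down[/negP[]]//|_].
rewrite /= (_ : x.2 != bcolor z = false) ?andbF ?subr0 ?scaler0 //.
by case: (x.2) (y.2) (bcolor z) xyc yc => [] [] [].
Qed.

Definition band_ext : lmodule4 k := ext_mod ext_d_idem ext_d_rel.
Local Notation E := band_ext.

Definition extv (u : 'cV[k]_(mdim P1)) (x : 'cV[k]_(mdim X)) : 'cV[k]_(mdim E) := col_mx u x.

Lemma ext_act x t : mact E x *m extv 0 (eps t) = extv (ext_col x t) (mact X x *m eps t).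
Proof. by rewrite /= mul_block_col mulmx0 add0r mul0mx add0r ext_dE. Qed.

Lemma letter_eq t : bletter t = ((bletter t).1, up t).
Proof. by rewrite /up; case: (bletter t). Qed.

Lemma ext_act_up t : up t ->
  mact E (bletter t).1 *m extv 0 (eps (ordS t)) = (mu t)^-1 *: extv 0 (eps t).
Proof.
move=> ut; have lt := letter_eq t; rewrite ut in lt.
have [_ xc _ _] := letter_up lt.
rewrite ext_act /ext_col band_act; case: eqP => [/letter_down[_ E]|_].
  by rewrite E eqxx in xc.
rewrite /= deepS ut /= subrr ordSK lt eqxx /extv.
by rewrite scale_col_mx scaler0.
Qed.

Lemma ext_act_down t : ~~ up t -> mact E (bletter t).1 *m extv 0 (eps t) =
  extv (if deep (ordS t) then w (ordS t) else 0) (mu t *: eps (ordS t)).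
Proof.
move=> ut; have lt := letter_eq t; rewrite (negbTE ut) in lt.
set x := (bletter t).1 in lt *; have [_ xc _ _] := letter_down lt.
by rewrite ext_act /ext_col band_act lt eqxx xc eqxx andbF subr0.
Qed.

Lemma ext_deep_w U t : stable E U -> deep t -> U (mact E (bletter (ord_pred t)).1
   *m extv 0 (eps (ord_pred t))) -> U (extv 0 (eps t)) -> U (extv (w t) 0).
Proof.
case=> _ UD UZ _ dt; have /andP[upt _] := dt.
rewrite ext_act_down // ord_predK dt => U1 U2.
have -> : extv (w t) 0 = extv (w t) (mu (ord_pred t) *: eps t) +
    (- mu (ord_pred t)) *: extv 0 (eps t).
  by rewrite /extv scale_col_mx add_col_mx scaler0 addr0 scaleNr subrr.
by apply: UD => //; apply: UZ.
Qed.

Lemma stable_left U : stable E U -> stable P1 (fun y => U (extv y 0)).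
Proof.
move=> [U0 UD UZ UA]; split.
- by rewrite /extv col_mx0.
- by move=> x y Ux Uy; have := UD _ _ Ux Uy; rewrite /extv add_col_mx addr0.
- by move=> c x Ux; have := UZ c _ Ux; rewrite /extv scale_col_mx scaler0.
- move=> a x Ux; have := UA a _ Ux; rewrite /extv /= mul_block_col.
  by rewrite !mulmx0 !mul0mx !addr0.
Qed.

(** Every basis vector is reached by descending from a peak; at a deep the two slopes then yield
    [w], and these vectors generate the submodule [P1]. *)
Lemma ext_gen U : stable E U -> (forall t, peak t -> U (extv 0 (eps t))) -> forall y, U y.
Proof.
move=> sU Up; have [U0 UD UZ UA] := sU.
have Ue t : U (extv 0 (eps t)).
  (* Induction from the highest vertex down: a position which is not a peak has a higher neighbour.
     A deep is reached from its climbing side, where no [w] appears. *)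
  move: {2}(3 - bheight t)%N (erefl (3 - bheight t)%N) => n.
  elim: n t => [|n IH] t hn.
    have [u|u] := boolP (up t); first by have := up_height_lt3 u; lia.
    have [up_p|up_p] := boolP (up (ord_pred t)); first by apply: Up; rewrite /peak up_p.
    have := bheight_lt4 (ord_pred t); have := down_height_gt0 up_p.
    have := up_height (ord_pred t); rewrite ord_predK (negbTE up_p); lia.
  have [ut|ut] := boolP (up t).
    have := UZ (mu t) _ (UA (bletter t).1 _ (IH (ordS t) _)).
    rewrite ext_act_up // scalerA mulfV ?scale1r ?bscalar_neq0 //; apply.
    by rewrite up_height ut; lia.
  have [up_p|up_p] := boolP (up (ord_pred t)); first by apply: Up; rewrite /peak up_p ut.
  have := UZ (mu (ord_pred t))^-1 _ (UA (bletter (ord_pred t)).1 _ (IH (ord_pred t) _)).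
  rewrite ext_act_down // ord_predK /deep (negbTE ut) andbF /extv.
  rewrite scale_col_mx scaler0 scalerA mulVf ?scale1r ?bscalar_neq0 //; apply.
  have := up_height (ord_pred t); rewrite ord_predK (negbTE up_p).
  by have := down_height_gt0 up_p; lia.
have Uw y : U (extv y 0).
  apply: (w_gen (stable_left sU)) => t dt.
  by apply: (ext_deep_w sU dt); [apply: UA|].
have UX (x : 'cV_(mdim X)) : U (extv 0 x).
  rewrite [x]delta_sum.
  apply: (big_ind (fun x => U (extv 0 x))); first exact: Uw.
    by move=> a b Ua Ub; have := UD _ _ Ua Ub; rewrite /extv add_col_mx addr0.
  move=> t _; have := UZ (x (enum_rank t) 0) _ (Ue t).
  by rewrite /extv scale_col_mx scaler0.
move=> y; rewrite -[y](@vsubmxK _ (mdim P1) (mdim X)) -[usubmx _]addr0 -[dsubmx _]add0r.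
by rewrite -add_col_mx; apply: UD; [apply: Uw|apply: UX].
Qed.

(** Each [w t] is a combination of the images of two arrows, one for each slope ending at the deep
    [t]. *)
Lemma ext_rad (y : 'cV[k]_(mdim P1)) : exists s : arrow -> 'cV_(mdim E),
  extv y 0 = \sum_x mact E x *m s x.
Proof.
pose R v := exists s : arrow -> 'cV_(mdim E), v = \sum_x mact E x *m s x.
have RA a v : R (mact E a *m v).
  exists (fun b => if b == a then v else 0); rewrite (bigD1 a) //= eqxx big1 ?addr0 //.
  by move=> b /negbTE ->; rewrite mulmx0.
have sR : stable E R.
  split=> //.
  - by exists (fun=> 0); rewrite big1 // => a _; rewrite mulmx0.
  - move=> _ _ [s ->] [s' ->]; exists (fun a => s a + s' a).
    by rewrite -big_split; apply: eq_bigr => a _; rewrite mulmxDr.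
  - move=> c _ [s ->]; exists (fun a => c *: s a); rewrite scaler_sumr.
    by apply: eq_bigr => a _; rewrite scalemxAr.
apply: (w_gen (stable_left sR)) => t dt; apply: (ext_deep_w sR dt); first exact: RA.
case: (sR) => _ _ RZ _; have /andP[_ ut] := dt.
have := RZ (mu t) _ (RA (bletter t).1 (extv 0 (eps (ordS t)))).
by rewrite ext_act_up // scalerA mulfV ?scale1r // bscalar_neq0.
Qed.

(** The peaks generate, so only the dimension is left. Since [P_i] has dimension [2 i + 1],
    [peak_deep_sum] gives the difference of the two sums of projectives as twice the number of
    climbs, which is the dimension of [X]. *)
Lemma band_ext_free : is_free E tops.
Proof.
split.
  have := peak_deep_sum (fun t => (bheight t).*2.+1%:Z).
  have -> : \sum_(t : 'I_r | up t) ((bheight (ordS t)).*2.+1%:Z - (bheight t).*2.+1%:Z) = r%:Z.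
    transitivity (\sum_(t in [pred t : 'I_r | up t]) 2%:Z).
      by apply: eq_big => [t|t ut]; rewrite ?inE // up_height ut; lia.
    by rewrite sumr_const -[in RHS](up_count z) -muln2 PoszM -mulr_natr natz mulrC.
  move=> H; transitivity (\sum_(i <- bots) (nat_of_ord i).*2.+1 + r)%N.
    by rewrite -(mdim_free k) -[in RHS](card_ord r).
  rewrite !big_map !big_filter !big_enum_cond /=.
  rewrite -[RHS]/(\sum_(t | peak t) (bheight t).*2.+1)%N.
  rewrite -[X in (X + _)%N]/(\sum_(t | deep t) (bheight t).*2.+1)%N.
  by move: H; rewrite -!(big_morph Posz PoszD (erefl _)); lia.
exists [seq (bvertex t, extv 0 (eps t)) | t <- enum 'I_r & peak t].
split; last by rewrite -map_comp.
split=> [p /mapP[t _ ->]|U sU UG y] /=.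
  by rewrite /extv mul_block_col !mulmx0 !mul0mx !add0r band_idem eqxx scale1r.
apply: ext_gen => // t pt; apply: (UG (bvertex t, _)); apply: (map_f (fun t => (_, _))).
by rewrite mem_filter pt mem_enum.
Qed.

Lemma band_resolved_aux : resolved X tops bots.
Proof.
exists E, P1, (col_mx 1%:M 0), (row_mx 0 1%:M); split.
- by split; [exact: band_ext_free|exact: is_free_free].
- split; split=> i /=.
  + by rewrite mul_block_col mul_col_mx !mulmx0 !mul0mx !addr0 mulmx1 mul1mx.
  + by rewrite mul_block_col mul_col_mx !mulmx0 !mul0mx !addr0 mulmx1 mul1mx.
  + by rewrite mul_row_block mul_mx_row !mulmx0 !mul0mx !add0r mulmx1 mul1mx.
  + by rewrite mul_row_block mul_mx_row !mulmx0 !mul0mx !add0r mulmx1 mul1mx.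
- split=> [y|y]; last by exists (col_mx 0 y); rewrite mul_row_col mulmx0 add0r mul1mx.
  by rewrite mul_col_mx mul1mx mul0mx => /col_mx_inj0[].
- move=> x; rewrite -[x](@vsubmxK _ (mdim P1) (mdim X)); split.
    rewrite mul_row_col mul0mx mul1mx add0r => ->; exists (usubmx x).
    by rewrite mul_col_mx mul1mx mul0mx.
  by move=> [y]; rewrite mul_col_mx mul1mx mul0mx => <-; rewrite mul_row_col mul0mx mulmx0 addr0.
- move=> y; have [s Es] := ext_rad y; exists s; rewrite -Es.
  by rewrite mul_col_mx mul1mx mul0mx.
Qed.
End BandResolution.

Lemma free_family (k : fieldType) (I : eqType) (s : seq I) (g : I -> vertex) :
  uniq s -> exists w : I -> 'cV[k]_(mdim (free_mod k (map g s))),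
    (forall t, t \in s -> midem (free_mod k (map g s)) (g t) *m w t = w t) /\
    forall U, stable (free_mod k (map g s)) U -> (forall t, t \in s -> U (w t)) ->
      forall y, U y.
Proof.
move=> us; have [_ [G [[Gv Gg] Gs]]] := is_free_free k (map g s).
pose p0 : vertex * 'cV[k]_(mdim (free_mod k (map g s))) := (ord0, 0).
have sz : size G = size s by rewrite -(size_map fst) Gs size_map.
have E1 t : t \in s -> (nth p0 G (index t s)).1 = g t.
  move=> ts; have lt : (index t s < size s)%N by rewrite index_mem.
  by rewrite -(nth_map _ ord0 fst) ?sz // Gs (nth_map t) // nth_index.
have inG t : t \in s -> nth p0 G (index t s) \in G.
  by move=> ts; rewrite mem_nth // sz index_mem.
exists (fun t => (nth p0 G (index t s)).2); split=> [t ts|U sU Uw y].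
  by have := Gv _ (inG t ts); rewrite E1.
apply: (Gg U sU) => p pG.
have lt : (index p G < size s)%N by rewrite -sz index_mem.
have [t0 _] : exists t0 : I, True.
  by move: (index p G) lt => n; clear; case: s => [|t0 s'] //; exists t0.
have := Uw (nth t0 s (index p G)) (mem_nth _ lt).
by rewrite index_uniq // nth_index.
Qed.

Lemma band_resolved (k : fieldType) (z : band) (l : k) : l != 0 ->
  resolved (band_mod z l) (tops z) (bots z).
Proof.
move=> l0.
have us : uniq [seq t <- enum 'I_(size (bwalk z)) | deep t] by rewrite filter_uniq ?enum_uniq.
have [w [w1 w2]] := free_family k (@bvertex z) us.
apply: (band_resolved_aux l0 (w := w)) => [t dt|U sU Uw y].
  by apply: w1; rewrite mem_filter dt mem_enum.
by apply: w2 => // t; rewrite mem_filter => /andP[dt _]; apply: Uw.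
Qed.

Definition nup (z : band) (i : nat) : nat :=
  #|[pred t : 'I_(size (bwalk z)) | up t && (bheight t == i)]|.

Lemma nup3 z : nup z 3 = 0%N.
Proof.
apply: eq_card0 => t; rewrite !inE; apply/negP => /andP[/up_height_lt3 H /eqP E].
by rewrite E in H.
Qed.

(* The i-th coordinate of the g-vector of a module with f j upward steps from j to j + 1. *)
Definition gcoord (f : nat -> nat) (i : nat) : int :=
  (if i is j.+1 then (f j)%:Z else 0) - (f i)%:Z.

Lemma sum_int_card (T : finType) (P : pred T) : \sum_(t | P t) 1 = #|P|%:Z :> int.
Proof. by rewrite sumr_const natz. Qed.

(** [peak_deep_sum] for the indicator of the vertex [i]: climbs that end at [i] count positively,
    those that start there negatively. *)
Lemma count_tops_bots z (i : vertex) :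
  (count_mem i (tops z))%:Z - (count_mem i (bots z))%:Z = gcoord (nup z) i.
Proof.
have := peak_deep_sum (fun t : 'I_(size (bwalk z)) => (bvertex t == i : nat)%:Z).
have cE (P : pred 'I_(size (bwalk z))) :
    (count_mem i [seq bvertex t | t <- enum 'I_(size (bwalk z)) & P t])%:Z =
    \sum_(t | P t) (bvertex t == i : nat)%:Z.
  rewrite -sum1_count big_map big_filter_cond big_enum_cond /=.
  rewrite (big_morph Posz PoszD (erefl _)) big_mkcondr /=.
  by apply: eq_bigr => t _; case: eqP.
rewrite -!cE -/(tops z) -/(bots z) => ->.
have nE j : (nup z j)%:Z = \sum_(t : 'I_(size (bwalk z)) | up t) (bheight t == j : nat)%:Z.
  rewrite /nup -sum_int_card big_mkcondr /=.
  by apply: eq_bigr => t _; case: eqP.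
rewrite sumrB /gcoord nE; congr (_ - _).
case: i {nE cE} (nE) => -[|j] lj nE.
  by apply: big1 => t ut; rewrite -val_eqE /= -/(bheight _) up_height ut.
rewrite /= nE; apply: eq_bigr => t ut.
by rewrite -val_eqE /= -/(bheight _) up_height ut eqSS.
Qed.

Definition gtuple (x y w : nat) : 4.-tuple int :=
  [tuple - x%:Z; x%:Z - y%:Z; y%:Z - w%:Z; w%:Z].

Lemma resolved_gtuple (k : fieldType) (X : lmodule4 k) s0 s1 f : f 3 = 0%N ->
  resolved X s0 s1 ->
  (forall i : vertex, (count_mem i s0)%:Z - (count_mem i s1)%:Z = gcoord f i) ->
  is_gvector X (gtuple (f 0) (f 1) (f 2)).
Proof.
move=> f3 RX E; apply: (resolved_gvector RX) => i; rewrite E.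
by case: i => -[|[|[|[|m]]]] lm //; rewrite (tnth_nth 0) /gcoord /= ?f3 ?sub0r ?subr0.
Qed.

Lemma band_gvector (k : fieldType) (z : band) (l : k) : l != 0 ->
  is_gvector (band_mod z l) (gtuple (nup z 0) (nup z 1) (nup z 2)).
Proof.
move=> l0; apply: resolved_gtuple (nup3 z) (band_resolved z l0) _.
exact: count_tops_bots.
Qed.

Lemma bands_gvector (k : fieldType) (s : seq (band * k)) :
  (forall p, p \in map snd s -> p != 0) ->
  is_gvector (dsums [seq band_mod p.1 p.2 | p <- s])
    (gtuple (\sum_(p <- s) nup p.1 0) (\sum_(p <- s) nup p.1 1) (\sum_(p <- s) nup p.1 2)).
Proof.
move=> s0; pose f i := (\sum_(p <- s) nup p.1 i)%N.
have f3 : f 3 = 0%N by rewrite /f big1 // => p _; apply: nup3.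
suff [t0 [t1 [R E]]] : exists t0 t1, resolved (dsums [seq band_mod p.1 p.2 | p <- s]) t0 t1 /\
    forall i : vertex, (count_mem i t0)%:Z - (count_mem i t1)%:Z = gcoord f i.
  exact: (resolved_gtuple (f := f)) R E.
clear f3; rewrite {}/f; elim: s s0 => [_|[z l] s IH s0].
  exists [::], [::]; split=> [|i]; first exact: resolved_zero.
  by rewrite /gcoord !big_nil; case: (nat_of_ord i) => [|j]; rewrite ?big_nil.
have [|t0 [t1 [R E]]] := IH; first by move=> p ps; apply: s0; rewrite inE ps orbT.
have l0 : l != 0 by apply: s0; rewrite mem_head.
exists (tops z ++ t0), (bots z ++ t1); split.
  exact: resolved_dsum (band_resolved z l0) R.
move=> i; rewrite !count_cat; have := E i; have := count_tops_bots z i.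
rewrite /gcoord !big_cons; case: (nat_of_ord i) => [|j]; rewrite ?big_cons /=; lia.
Qed.

(** * Homomorphisms between band modules *)

(** Height and direction determine the edge, and the colour of the band then determines the
    arrow. *)
Lemma bletter_same (z z' : band) (p : 'I_(size (bwalk z))) (q : 'I_(size (bwalk z'))) :
  bcolor z = bcolor z' -> up p = up q -> bheight p = bheight q -> bletter p = bletter q.
Proof.
move=> cE uE hE; rewrite (letter_eq p) (letter_eq q) uE; congr (_, _).
have i_eq : (bletter p).1.1 = (bletter q).1.1.
  by apply: val_inj; rewrite /= !bletter_index uE hE !up_height uE hE.
have c_eq : (bletter p).1.2 = (bletter q).1.2 by rewrite !bletter_color cE uE.
by rewrite [LHS]surjective_pairing i_eq c_eq -surjective_pairing.
Qed.

Section Homs.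
Variables (k : fieldType) (z z' : band) (l l' : k).
Hypotheses (l0 : l != 0) (l'0 : l' != 0) (cE : bcolor z = bcolor z').
Local Notation X := (band_mod z l).
Local Notation Y := (band_mod z' l').
Local Notation I := 'I_(size (bwalk z)).
Local Notation J := 'I_(size (bwalk z')).
Variable f : 'M[k]_(mdim Y, mdim X).

Definition hcoef (q : J) (p : I) : k := f (enum_rank q) (enum_rank p).
Local Notation F := hcoef.

Lemma hom_midem_coef i q p :
  (f *m midem X i) (enum_rank q) (enum_rank p) = F q p * (bvertex p == i)%:R /\
  (midem Y i *m f) (enum_rank q) (enum_rank p) = (bvertex q == i)%:R * F q p.
Proof.
by rewrite /= mul_mx_diag mul_diag_mx !mxE !enum_rankK.
Qed.

Lemma mul_act_coef x q p : (f *m mact X x) (enum_rank q) (enum_rank p) =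
  if bletter p == (x, false) then bscalar l p * F q (ordS p)
  else if bletter (ord_pred p) == (x, true)
    then (bscalar l (ord_pred p))^-1 * F q (ord_pred p) else 0.
Proof.
transitivity ((f *m (mact X x *m bvec l p)) (enum_rank q) 0).
  by rewrite mulmxA /bvec -colE [RHS]mxE.
have fv t : (f *m bvec l t) (enum_rank q) 0 = F q t by rewrite /bvec -colE mxE.
rewrite band_act; case: ifP => _; last case: ifP => _.
- by rewrite -scalemxAr mxE fv.
- by rewrite -scalemxAr mxE fv.
- by rewrite mulmx0 mxE.
Qed.

Lemma act_mul_coef x q p : (mact Y x *m f) (enum_rank q) (enum_rank p) =
  if bletter (ord_pred q) == (x, false) then bscalar l' (ord_pred q) * F (ord_pred q) p
  else if bletter q == (x, true) then (bscalar l' q)^-1 * F (ordS q) p else 0.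
Proof.
transitivity (\sum_(y : J) band_coef l' x q y * F y p).
  rewrite mxE; under eq_bigr => y _ do rewrite mxE enum_rankK.
  rewrite (reindex (fun y : J => enum_rank y : 'I_(mdim Y))) /=.
    by apply: eq_bigr => y _; rewrite enum_rankK.
  exact: onW_bij (enum_rank_bij _).
rewrite /band_coef.
case: ifP => lp; last case: ifP => lq.
- rewrite (bigD1 (ord_pred q)) //= big1 ?addr0 => [|y yq]; first by rewrite lp ord_predK eqxx.
  case: ifP => [/andP[_ /eqP E]|_]; first by rewrite E ordSK eqxx in yq.
  case: ifP => [/andP[/eqP lq _]|_]; last by rewrite mul0r.
  have /and4P[_ /eqP[]] := band_step (ord_pred q).
  by rewrite ord_predK (eqP lp) lq.
- rewrite (bigD1 (ordS q)) //= big1 ?addr0 => [|y yq].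
    case: ifP => [/andP[/eqP E /eqP E']|_]; last by rewrite ?lq eqxx.
    by rewrite [in ord_pred _]E' ordSK E eqxx in lp.
  case: ifP => [/andP[E /eqP E']|_]; first by rewrite E' ordSK E in lp.
  by rewrite ?lq /= (negbTE yq) mul0r.
rewrite big1 // => y _.
case: ifP => [/andP[E /eqP E']|_]; first by rewrite E' ordSK E in lp.
by rewrite ?lq /= mul0r.
Qed.

Lemma hom_height : is_hom f -> forall q p, F q p != 0 -> bheight p = bheight q.
Proof.
move=> [f1 _] q p Fqp; have /(congr1 (fun A : 'M_(_, _) => A (enum_rank q) (enum_rank p))) := f1 (bvertex p).
rewrite (hom_midem_coef _ q p).1 (hom_midem_coef _ q p).2 eqxx mulr1.
have [E|_] := eqVneq (bvertex q) (bvertex p); first by rewrite /bheight E.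
by rewrite mul0r => E; rewrite E eqxx in Fqp.
Qed.

(** Both steps use the same arrow [x], and the entries of [f x = x f] are compared. In a climb [x]
    runs backwards and the inverse scalars enter, with the same outcome. *)
Lemma hom_same : is_hom f -> forall q p, bheight p = bheight q -> up p = up q ->
  bscalar l p * F (ordS q) (ordS p) = bscalar l' q * F q p.
Proof.
move=> [_ f2] q p hE uE; have lE := bletter_same cE uE hE.
have lp := letter_eq p; set x := (bletter p).1 in lp.
have := f2 x; case: (boolP (up p)) lp => u lp E; have lq := lp; rewrite lE in lq.
  have /(congr1 (fun A : 'M_(_, _) => A (enum_rank q) (enum_rank (ordS p)))) := E.
  rewrite mul_act_coef act_mul_coef ordSK.
  have [_ xc _ _] := letter_up lp.
  case: eqP => [/letter_down[_ E1]|_]; first by rewrite E1 eqxx in xc.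
  rewrite lp lq !eqxx; case: eqP => [/letter_down[_ E1]|_ H].
    by rewrite E1 cE eqxx in xc.
  rewrite -[LHS]mul1r -(mulfV (bscalar_neq0 q l'0)) -mulrA [_^-1 * _]mulrCA -H.
  by rewrite mulVKf ?bscalar_neq0.
have /(congr1 (fun A : 'M_(_, _) => A (enum_rank (ordS q)) (enum_rank p))) := E.
by rewrite mul_act_coef act_mul_coef ordSK lp lq eqxx.
Qed.

(** The vector at [p] is in the image of the arrow climbed from [p], while no element of the image
    of this arrow has a component at [q]. *)
Lemma hom_up_down : is_hom f -> forall q p, up p -> ~~ up q -> F q p = 0.
Proof.
move=> [_ f2] q p upp uq; have lp := letter_eq p; rewrite upp in lp.
have /(congr1 (fun A : 'M_(_, _) => A (enum_rank q) (enum_rank (ordS p)))) := f2 (bletter p).1.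
set x := (bletter p).1 in lp *; have [_ xc _ _] := letter_up lp.
rewrite mul_act_coef act_mul_coef ordSK.
case: eqP => [/letter_down[_ E1]|_]; first by rewrite E1 eqxx in xc.
rewrite lp eqxx; case: eqP => [/letter_down[_ E1]|_]; first by rewrite E1 cE eqxx in xc.
case: eqP => [/letter_up[E1]|_]; first by rewrite E1 in uq.
move=> /eqP; rewrite mulf_eq0 invr_eq0 (negbTE (bscalar_neq0 _ _)) //.
by move/eqP.
Qed.

(** The same obstruction at the other end: the vector reached by descending from [p] is in the image
    of an arrow whose image has no component at the successor of [q]. *)
Lemma hom_down_up : is_hom f -> forall q p, ~~ up p -> up q -> F (ordS q) (ordS p) = 0.
Proof.
move=> [_ f2] q p upp uq; have lp := letter_eq p; rewrite (negbTE upp) in lp.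
have /(congr1 (fun A : 'M_(_, _) => A (enum_rank (ordS q)) (enum_rank p))) := f2 (bletter p).1.
set x := (bletter p).1 in lp *; have [_ xc _ _] := letter_down lp.
rewrite mul_act_coef act_mul_coef ordSK lp eqxx.
case: eqP => [/letter_down[E1]|_]; first by rewrite uq in E1.
case: eqP => [/letter_up[_ E1]|_]; first by rewrite xc cE eqxx in E1.
by move=> /eqP; rewrite mulf_eq0 (negbTE (bscalar_neq0 _ _)) // => /eqP.
Qed.

(** Entries of [f x] and [x f] where both sides are present agree by the second hypothesis. Where
    only one is present, either the directions differ and one of the last two hypotheses applies, or
    the heights differ. *)
Lemma hom_criterion :
  (forall q p, F q p != 0 -> bheight p = bheight q) ->
  (forall q p, bheight p = bheight q -> up p = up q ->
     bscalar l p * F (ordS q) (ordS p) = bscalar l' q * F q p) ->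
  (forall q p, up p -> ~~ up q -> F q p = 0) ->
  (forall q p, ~~ up p -> up q -> F (ordS q) (ordS p) = 0) -> is_hom f.
Proof.
move=> H0 H1 H2 H3.
have F0 q p : bheight p <> bheight q -> F q p = 0.
  by move=> ne; apply/eqP; apply: contra_notT ne => /H0.
have ext (A B : 'M_(mdim Y, mdim X)) :
    (forall q p, A (enum_rank q) (enum_rank p) = B (enum_rank q) (enum_rank p)) -> A = B.
  by move=> E; apply/matrixP=> a b; rewrite -(enum_valK a) -(enum_valK b).
have vE (q : J) (p : I) x b : bletter q = (x, b) -> up p = b -> bheight p = bheight q ->
    bletter p = (x, b).
  move=> lq uE hE; rewrite -lq; apply: bletter_same => //.
  by rewrite uE /up lq.
have vE' (q : J) (p : I) x b : bletter p = (x, b) -> up q = b -> bheight p = bheight q ->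
    bletter q = (x, b).
  move=> lp uE hE; rewrite -lp; symmetry; apply: bletter_same => //.
  by rewrite uE /up lp.
split=> [i|x]; apply: ext => q p.
  rewrite (hom_midem_coef _ q p).1 (hom_midem_coef _ q p).2 mulrC.
  have [->|/H0 hE] := eqVneq (F q p) 0; first by rewrite !mulr0.
  by rewrite (_ : bvertex p = bvertex q) //; apply: val_inj.
rewrite mul_act_coef act_mul_coef.
have [xc|xc] := eqVneq x.2 (bcolor z).
  rewrite [bletter (ord_pred p) == _](introF eqP) => [|/letter_up[_ E]]; last first.
    by rewrite xc eqxx in E.
  rewrite [bletter q == _](introF eqP) => [|/letter_up[_ E]]; last first.
    by rewrite xc cE eqxx in E.
  have := H1 (ord_pred q) p; have := H3 (ord_pred q) p; have := H2 (ord_pred q) p.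
  rewrite ord_predK => h2 h3 h1.
  case: eqP => [lp|lp]; case: eqP => [lq|lq] //.
  - have [up_p _ vp _] := letter_down lp; have [up_q _ vq _] := letter_down lq.
    by rewrite h1 ?(negbTE up_p) ?(negbTE up_q) // /bheight vp vq.
  - have [up_p _ vp _] := letter_down lp.
    have [up_q|up_q] := boolP (up (ord_pred q)); first by rewrite h3 ?mulr0.
    have [hE|/eqP hE] := eqVneq (bheight p) (bheight (ord_pred q)).
      by case: lq; apply: vE' lp _ hE; apply: negbTE.
    rewrite F0 ?mulr0 //; have := up_height (ord_pred q); rewrite ord_predK => ->.
    rewrite up_height (negbTE up_p) (negbTE up_q).
    have := down_height_gt0 up_p; have := down_height_gt0 up_q; lia.
  - have [up_q _ vq _] := letter_down lq.
    have [up_p|up_p] := boolP (up p); first by rewrite h2 ?mulr0.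
    rewrite F0 ?mulr0 // => hE; case: lp; apply: vE lq _ hE; exact: negbTE.
rewrite [bletter p == _](introF eqP) => [|/letter_down[_ E]]; last first.
  by rewrite E eqxx in xc.
rewrite [bletter (ord_pred q) == _](introF eqP) => [|/letter_down[_ E]]; last first.
  by rewrite E cE eqxx in xc.
have := H1 q (ord_pred p); have := H3 q (ord_pred p); have := H2 q (ord_pred p).
rewrite ord_predK => h2 h3 h1.
case: eqP => [lp|lp]; case: eqP => [lq|lq] //.
- have [up_p _ vp _] := letter_up lp; have [up_q _ vq _] := letter_up lq.
  have E : bscalar l (ord_pred p) * F (ordS q) p = bscalar l' q * F q (ord_pred p).
    by rewrite h1 ?up_p ?up_q // /bheight vp vq.
  apply: (mulfI (bscalar_neq0 (ord_pred p) l0)); rewrite mulrA mulfV ?bscalar_neq0 //.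
  rewrite mul1r mulrCA E mulrA mulVf ?bscalar_neq0 // mul1r //.
- have [up_p _ vp _] := letter_up lp.
  have [up_q|up_q] := boolP (up q); last by rewrite h2 ?mulr0.
  rewrite F0 ?mulr0 // => hE; case: lq; exact: vE' lp up_q hE.
- have [up_q _ vq _] := letter_up lq.
  have [up_p|up_p] := boolP (up (ord_pred p)); last by rewrite h3 ?mulr0.
  have [hE|/eqP hE] := eqVneq (bheight (ord_pred p)) (bheight q).
    by case: lp; exact: vE lq up_p hE.
  rewrite F0 ?mulr0 //; have := up_height (ord_pred p); rewrite ord_predK => ->.
  by rewrite up_height up_p up_q => -[].
Qed.
End Homs.

(** * Strand diagrams *)

Section Strands.
Variables x y w : nat.
Local Open Scope nat_scope.

(* Level j stands for the vertex j + 1, and [edges j] is the number of strands going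
   from level j to level j - 1 or back. *)
Definition edges (j : nat) : nat := nth 0 [:: 0; x; y; w] j.

(** The number [x + y + w] bounds all levels at once and provides a finite ambient type, which is
    then cut down level by level. *)
Definition strand_ok (p : 'I_4 * 'I_(x + y + w).+1) : bool :=
  p.2 < edges p.1 + edges p.1.+1.

Definition strand : finType := {p | strand_ok p}.
Implicit Types p q : strand.

Definition lev p : nat := (val p).1.
Definition pos p : nat := (val p).2.

Lemma strand_inj p q : lev p = lev q -> pos p = pos q -> p = q.
Proof.
move=> E1 E2; apply: val_inj; rewrite (surjective_pairing (val p)).
by rewrite (surjective_pairing (val q)); congr (_, _); apply: val_inj.
Qed.

Lemma lev_lt4 p : lev p < 4. Proof. exact: ltn_ord. Qed.

Lemma pos_lt p : pos p < edges (lev p) + edges (lev p).+1.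
Proof. exact: valP p. Qed.

Lemma strand_ex a i : a < 4 -> i < edges a + edges a.+1 ->
  exists p, lev p = a /\ pos p = i.
Proof.
move=> a4 ia.
have iN : i < (x + y + w).+1 by case: a a4 ia => [|[|[|[|a]]]] //= _; rewrite /edges /=; lia.
have ok : strand_ok (Ordinal a4, Ordinal iN) by [].
by exists (Sub (Ordinal a4, Ordinal iN) ok).
Qed.

Definition rises p : bool := edges (lev p) <= pos p.

Lemma rises_lt3 p : rises p -> lev p < 3.
Proof.
rewrite /rises; have := pos_lt p; have := lev_lt4 p.
by case: (lev p) => [|[|[|[|a]]]] //=; rewrite /edges /=; lia.
Qed.

Lemma falls_gt0 p : ~~ rises p -> 0 < lev p.
Proof. by rewrite /rises; case: (lev p). Qed.

(* At each level the strands which came from above lie below those which came from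
   below, and each bundle is moved without changing the order. *)
Definition advance p : strand :=
  insubd p (inord (if rises p then (lev p).+1 else (lev p).-1),
            inord (if rises p then pos p + edges (lev p).+2 - edges (lev p) else pos p)).

(** The new coordinates are legitimate, so the default value in [advance] and those of [inord] never
    occur. *)
Lemma advance_ok p :
  let a := if rises p then (lev p).+1 else (lev p).-1 in
  let i := if rises p then pos p + edges (lev p).+2 - edges (lev p) else pos p in
  [/\ a < 4, i < (x + y + w).+1 & i < edges a + edges a.+1].
Proof.
have := @rises_lt3 p; have := @falls_gt0 p; have := pos_lt p; rewrite /rises.
case: (leqP (edges (lev p)) (pos p)) => ep pl fl ri.
  move: (ri isT) ep pl; case: (lev p) => [|[|[|a]]] // _;
    by rewrite /edges /= => *; split=> //; lia.
move: (fl isT) (lev_lt4 p) ep pl; case: (lev p) => [|[|[|[|a]]]] // _ _;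
  by rewrite /edges /= => *; split=> //; lia.
Qed.

Lemma val_advance p :
  lev (advance p) = (if rises p then (lev p).+1 else (lev p).-1) /\
  pos (advance p) = (if rises p then pos p + edges (lev p).+2 - edges (lev p) else pos p).
Proof.
have [a4 iN ok] := advance_ok p.
rewrite /lev /pos /advance val_insubd /strand_ok /= !inordK //.
by rewrite ok /= !inordK.
Qed.

Lemma lev_advance p : lev (advance p) = if rises p then (lev p).+1 else (lev p).-1.
Proof. by case: (val_advance p). Qed.

Lemma pos_advance p :
  pos (advance p) = if rises p then pos p + edges (lev p).+2 - edges (lev p) else pos p.
Proof. by case: (val_advance p). Qed.

Lemma advance_diff p q : lev p = lev q -> rises p = rises q ->
  pos (advance p) + pos q = pos (advance q) + pos p.
Proof.
move=> lE rE; rewrite !pos_advance -rE -lE.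
have : rises q -> edges (lev p) <= pos q by rewrite lE.
have : rises p -> edges (lev p) <= pos p by [].
by rewrite -rE; case: (rises p) => [/(_ isT) ? /(_ isT) ?|_ _]; lia.
Qed.

Lemma falls_below p q : lev p = lev q -> ~~ rises p -> rises q -> pos p < pos q.
Proof. by rewrite /rises => ->; lia. Qed.

Lemma advance_below p q : lev (advance p) = lev (advance q) -> ~~ rises p -> rises q ->
  pos (advance p) < pos (advance q).
Proof.
rewrite !lev_advance !pos_advance => + rp rq; rewrite rq (negbTE rp).
have := falls_gt0 rp; move: rp rq; rewrite /rises => rp rq lp lE.
have {}lE : lev p = (lev q).+2 by lia.
by move: rp; rewrite lE; lia.
Qed.

(** Strands which arrive at a level from opposite sides occupy disjoint ranges of positions, and a
    bundle arriving from one side keeps its offsets. *)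
Lemma advance_inj : injective advance.
Proof.
move=> p q E; have lE : lev (advance p) = lev (advance q) by rewrite E.
have rE : rises p = rises q.
  have [rp|rp] := boolP (rises p); have [rq|rq] := boolP (rises q) => //.
    by have := advance_below (esym lE) rq rp; rewrite E ltnn.
  by have := advance_below lE rp rq; rewrite E ltnn.
have lpq : lev p = lev q.
  move: lE; rewrite !lev_advance -rE; case: ifP => [_ []//|/negbT rp].
  have := falls_gt0 rp; have := falls_gt0 (p := q); rewrite -rE => /(_ rp); lia.
apply: strand_inj => //; have := advance_diff lpq rE; rewrite E; lia.
Qed.

Lemma iter_diff p q n : lev p = lev q ->
  (forall m, m < n -> rises (iter m advance p) = rises (iter m advance q)) ->
  lev (iter n advance p) = lev (iter n advance q) /\
  pos (iter n advance p) + pos q = pos (iter n advance q) + pos p.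
Proof.
move=> lE; elim: n => [|n IH] rE; first by split=> //=; lia.
have [|l1 p1] := IH; first by move=> m mn; apply: rE; apply: ltnW.
have rn := rE n (ltnSn n); split; first by rewrite !iterS !lev_advance l1 rn.
by rewrite !iterS; move: (advance_diff l1 rn) p1; lia.
Qed.

(* The offset between p and advance^n p, which travel in parallel for ever, is repeated
   along the orbit, hence is 0. *)
Lemma parallel_eq p n : lev p = lev (iter n advance p) ->
  (forall m, rises (iter m advance p) = rises (iter m advance (iter n advance p))) ->
  iter n advance p = p.
Proof.
set q := iter n advance p => lE rE.
have D m : pos (iter m advance p) + pos q = pos (iter m advance q) + pos p.
  by have [] := iter_diff (n := m) lE (fun i _ => rE i).
have S j : pos (iter (j * n) advance p) + j * pos p = pos p + j * pos q.
  elim: j => [|j IH]; first by rewrite !mul0n !addn0.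
  have := D (j * n); rewrite /q -iterD -mulSnr => H.
  by move: IH H; rewrite -/q !mulSn; lia.
have := S (order advance p); rewrite mulnC iterM.
have fixp m : iter m (iter (order advance p) advance) p = p.
  by elim: m => //= m ->; apply: iter_order advance_inj _.
have o0 : 0 < order advance p by apply: order_gt0.
rewrite fixp => /addnI/eqP; rewrite eqn_mul2l => /orP[/eqP E|/eqP E].
  by rewrite E in o0.
by apply: strand_inj.
Qed.

End Strands.

Lemma nth_walk_pow l0 (s : seq letter) n i : (i < n * size s)%N ->
  nth l0 (walk_pow s n) i = nth l0 s (i %% size s).
Proof.
elim: n i => [|n IH] i; rewrite ?mul0n // mulSn => lt.
rewrite /walk_pow /= nth_cat; case: ltnP => le; first by rewrite modn_small.
rewrite IH; last by lia.
by rewrite -[in RHS](subnKC le) modnDl.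
Qed.

Lemma iter_modn (T : Type) (f : T -> T) p m n : iter m f p = p ->
  iter n f p = iter (n %% m) f p.
Proof.
move=> E; rewrite {1}(divn_eq n m) addnC iterD; congr iter.
by rewrite iterM; elim: (n %/ m)%N => //= j ->.
Qed.

(** * The closed curves of the diagram are bands *)

Section Orbits.
Variables x y w : nat.
Local Notation strand := (strand x y w).
Implicit Types p q : strand.

(** Descents use the arrows alpha and climbs the inverses of the arrows beta, so that consecutive
    letters neither cancel nor meet a relation. *)
Definition letter_of p : letter :=
  if rises p then ((inord (lev p), false), true) else ((inord (lev p).-1, true), false).

Lemma lsrc_letter_of p : lsrc (letter_of p) = lev p :> nat.
Proof.
rewrite /letter_of /lsrc; have [ri|ri] := boolP (rises p);
  [have lt := rises_lt3 ri | have lt := falls_gt0 ri] => /=.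
  by rewrite inordK.
have l4 := lev_lt4 p; rewrite /bump leq0n inordK /=; lia.
Qed.

Lemma ltgt_letter_of p : ltgt (letter_of p) = lev (advance p) :> nat.
Proof.
rewrite lev_advance /letter_of /ltgt; have [ri|ri] := boolP (rises p);
  [have lt := rises_lt3 ri | have lt := falls_gt0 ri] => /=.
  by rewrite /bump leq0n inordK /=; lia.
have l4 := lev_lt4 p; rewrite inordK; lia.
Qed.

Lemma letter_of_dir p : (letter_of p).2 = rises p.
Proof. by rewrite /letter_of; case: ifP. Qed.

Lemma letter_of_color p : (letter_of p).1.2 = ~~ rises p.
Proof. by rewrite /letter_of; case: ifP. Qed.

Lemma letter_of_step p : string_step (letter_of p) (letter_of (advance p)).
Proof.
have c1 := letter_of_color p; have c2 := letter_of_color (advance p).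
have d1 := letter_of_dir p; have d2 := letter_of_dir (advance p).
apply/and4P; split.
- by rewrite -val_eqE /= ltgt_letter_of lsrc_letter_of.
- apply/eqP => E; have E1 := congr1 snd E; have E2 := congr1 (fun l : letter => l.1.2) E.
  by move: E1 E2; rewrite /= c1 c2 d1 d2; case: (rises _) (rises _) => [] [].
- by rewrite /lrel4 /rel4 c1 c2 d1 d2; case: (rises _) (rises _) => [] []; rewrite ?andbF.
- by rewrite /lrel4 /rel4 /= c1 c2 d1 d2; case: (rises _) (rises _) => [] []; rewrite ?andbF.
Qed.

Definition orbit_walk p : seq letter := map letter_of (orbit (@advance x y w) p).

Lemma size_orbit_walk p : size (orbit_walk p) = order (@advance x y w) p.
Proof. by rewrite size_map size_orbit. Qed.

Lemma orbit_walk_pow p n :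
  walk_pow (orbit_walk p) n = map letter_of (traject (@advance x y w) p (n * order (@advance x y w) p)).
Proof.
rewrite /walk_pow /orbit_walk -map_nseq -map_flatten /orbit; congr map.
elim: n => [|n IH] //=; rewrite mulSn trajectD iter_order ?IH //; exact: advance_inj.
Qed.

Lemma traject_string p n : string_walk (map letter_of (traject (@advance x y w) p n)).
Proof.
case: n => // n; rewrite /string_walk /= path_map.
apply: sub_path (fpath_traject _ _ _) => a b /eqP <-; exact: letter_of_step.
Qed.

Lemma nth_orbit_walk l0 p i : (i < order (@advance x y w) p)%N ->
  nth l0 (orbit_walk p) i = letter_of (iter i (@advance x y w) p).
Proof.
by move=> lt; rewrite (nth_map p) ?size_orbit // nth_traject.
Qed.

(** If the walk were a proper power of [u], then [p] and its translate by the length of [u] would be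
    parallel for ever, hence equal, although this length is less than the period of [p]. *)
Lemma orbit_band p : band_walk (orbit_walk p).
Proof.
have o0 : (0 < order (@advance x y w) p)%N by apply: order_gt0.
split.
- exact: traject_string.
- rewrite /orbit_walk /orbit -(prednK o0) /= last_map last_traject -val_eqE /=.
  by rewrite ltgt_letter_of lsrc_letter_of -iterS prednK // iter_order //; apply: advance_inj.
- move=> u n _ n1 E; have := congr1 size E.
  rewrite size_orbit_walk /walk_pow size_flatten /shape map_nseq sumn_nseq mulnC => oE.
  have m0 : (0 < size u)%N by move: o0; rewrite oE; lia.
  pose l0 := letter_of p.
  have L i : letter_of (iter i (@advance x y w) p) = nth l0 u (i %% size u).
    rewrite (iter_modn i (iter_order (@advance_inj x y w) p)).
    rewrite -(nth_orbit_walk l0) ?ltn_mod // E nth_walk_pow; last by rewrite -oE ltn_mod.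
    by rewrite oE modn_dvdm // dvdn_mull.
  have P i : letter_of (iter i (@advance x y w) (iter (size u) (@advance x y w) p)) =
      letter_of (iter i (@advance x y w) p).
    by rewrite -iterD !L modnDr.
  have fix_p : iter (size u) (@advance x y w) p = p.
    apply: parallel_eq => [|i]; last by rewrite -!letter_of_dir P.
    by rewrite -!lsrc_letter_of; have /= -> := P 0%N.
  have : uniq (orbit (@advance x y w) p) by apply: orbit_uniq.
  have lt : (size u < order (@advance x y w) p)%N by rewrite oE; nia.
  move/(uniqP p)/(_ 0%N (size u)); rewrite !inE size_orbit o0 lt => /(_ isT isT).
  rewrite !nth_traject //= fix_p => /(_ erefl) u0; by rewrite -u0 in m0.
- by move=> n; rewrite orbit_walk_pow; apply: traject_string.
Qed.

Definition orb p : band := Band (orbit_band p).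
Local Notation I p := ('I_(size (bwalk (orb p)))).

Definition theta p (t : I p) : strand := iter t (@advance x y w) p.

Lemma bletter_orb p (t : I p) : bletter t = letter_of (theta t).
Proof.
rewrite /bletter (tnth_nth (letter_of p)) /= nth_orbit_walk //.
by rewrite -size_orbit_walk; apply: ltn_ord.
Qed.

Lemma up_orb p (t : I p) : up t = rises (theta t).
Proof. by rewrite /up bletter_orb letter_of_dir. Qed.

Lemma bheight_orb p (t : I p) : bheight t = lev (theta t).
Proof. by rewrite /bheight /bvertex bletter_orb lsrc_letter_of. Qed.

Lemma bcolor_orb p : bcolor (orb p) = true.
Proof.
by rewrite /bcolor /color bletter_orb letter_of_color letter_of_dir; case: (rises _).
Qed.

Lemma thetaS p (t : I p) : theta (ordS t) = advance (theta t).
Proof.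
rewrite /theta -iterS [RHS](iter_modn _ (iter_order (@advance_inj x y w) p)).
by congr (iter (_ %% _) _ _); apply: size_orbit_walk.
Qed.

Lemma theta_inj p : injective (@theta p).
Proof.
move=> s t E; apply: val_inj => /=.
have : uniq (orbit (@advance x y w) p) by apply: orbit_uniq.
have lo (i : I p) : (i < order (@advance x y w) p)%N.
  by rewrite -size_orbit_walk; apply: ltn_ord.
move/(uniqP p)/(_ s t); rewrite !inE size_orbit !lo => /(_ isT isT).
by rewrite !nth_traject //; apply.
Qed.

Lemma theta_connect p (t : I p) : fconnect (@advance x y w) p (theta t).
Proof. exact: fconnect_iter. Qed.

Lemma theta_surj p q : fconnect (@advance x y w) p q -> exists t : I p, theta t = q.
Proof.
move=> pq; have lt : (findex (@advance x y w) p q < size (bwalk (orb p)))%N.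
  by rewrite /= size_orbit_walk; apply: findex_max.
by exists (Ordinal lt); rewrite /theta /= iter_findex.
Qed.

Lemma theta_iter p (t : I p) n : theta (iter n (@ordS _) t) = iter n (@advance x y w) (theta t).
Proof. by elim: n => //= n IH; rewrite thetaS IH. Qed.
End Orbits.

(** On a finite set [v] returns to itself under [g], so going backwards from [v] around its cycle
    leads to [g v]. *)
Lemma backward_closed (T : finType) (g : T -> T) (P : pred T) : injective g ->
  (forall v, P (g v) -> P v) -> forall v, P v -> P (g v).
Proof.
move=> gi back v Pv; have : P (iter (order g v).-1.+1 g v).
  by rewrite prednK ?order_gt0 // iter_order.
by elim: (order g v).-1 => [//|n IH] /= H; apply/IH/back.
Qed.

Lemma val_iter_ordS r (t : 'I_r) n : iter n (@ordS r) t = ((t + n) %% r)%N :> nat.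
Proof.
elim: n => [|n IH]; first by rewrite addn0 modn_small.
by rewrite iterS /= IH -addn1 modnDml addn1 addnS.
Qed.

Lemma iter_ordS_dvd r (t : 'I_r) n : iter n (@ordS r) t = t <-> (r %| n)%N.
Proof.
split=> [/(congr1 val)|rn].
  rewrite /= val_iter_ordS -{2}(modn_small (ltn_ord t)) -{2}[nat_of_ord t]addn0 => /eqP.
  by rewrite eqn_modDl mod0n.
apply: val_inj; rewrite /= val_iter_ordS -modnDmr (eqP rn) addn0 modn_small //.
Qed.

(** One turn around the band meets the parameter exactly once. *)
Lemma prod_bscalar (k : fieldType) (z : band) (l : k) (p : 'I_(size (bwalk z))) :
  \prod_(i < size (bwalk z)) bscalar l (iter i (@ordS _) p) = l.
Proof.
have hi : injective (fun i : 'I_(size (bwalk z)) => iter i (@ordS _) p).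
  move=> i j /(congr1 val); rewrite /= !val_iter_ordS => /eqP.
  by rewrite eqn_modDl !modn_small // => /eqP/val_inj.
rewrite -(reindex_inj hi (P := xpredT) (F := fun t => bscalar l t)).
have r0 := band_size z.
have lt : ((size (bwalk z)).-1 < size (bwalk z))%N by rewrite prednK.
rewrite (bigD1 (Ordinal lt)) //= big1 => [|t /eqP tn].
  by rewrite /bscalar /= prednK // eqxx mulr1.
rewrite /bscalar; case: eqP => // E; case: tn; apply: val_inj => /=.
exact: (congr1 predn E).
Qed.

(** * Morphisms between the closed curves *)

Section OrbitHoms.
Variables (k : fieldType) (x y w : nat) (a b : strand x y w) (l l' : k).
Hypotheses (l0 : l != 0) (l'0 : l' != 0).
Local Notation X := (band_mod (orb a) l).
Local Notation Y := (band_mod (orb b) l').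
Local Notation I := 'I_(size (bwalk (orb a))).
Local Notation J := 'I_(size (bwalk (orb b))).
Local Notation adv := (@advance x y w).
Variable f : 'M[k]_(mdim Y, mdim X).
Hypothesis hf : is_hom f.
Local Notation F := (@hcoef k (orb a) (orb b) l l' f).

Let cE : bcolor (orb a) = bcolor (orb b). Proof. by rewrite !bcolor_orb. Qed.

Lemma orb_lev (q : J) (p : I) : F q p != 0 -> lev (theta p) = lev (theta q).
Proof. by move/(hom_height hf); rewrite !bheight_orb. Qed.

Lemma orb_same (q : J) (p : I) : lev (theta p) = lev (theta q) ->
  rises (theta p) = rises (theta q) ->
  bscalar l p * F (ordS q) (ordS p) = bscalar l' q * F q p.
Proof.
by move=> lE rE; apply: (hom_same l0 l'0 cE hf); rewrite ?bheight_orb ?up_orb.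
Qed.

Lemma orb_same0 (q : J) (p : I) : lev (theta p) = lev (theta q) ->
  rises (theta p) = rises (theta q) -> (F (ordS q) (ordS p) != 0) = (F q p != 0).
Proof.
move=> lE rE; have := orb_same lE rE => /(congr1 (fun c => c != 0)).
by rewrite !mulf_eq0 !negb_or !bscalar_neq0.
Qed.

Definition above (v : J * I) : bool :=
  (F v.1 v.2 != 0) && (pos (theta v.1) < pos (theta v.2))%N.
Definition below (v : J * I) : bool :=
  (F v.1 v.2 != 0) && (pos (theta v.2) < pos (theta v.1))%N.
Definition shift (v : J * I) : J * I := (ordS v.1, ordS v.2).

Lemma shift_inj : injective shift.
Proof.
have oi n := bij_inj (ordS_bij n).
move=> [q p] [q' p'] E; congr (_, _); apply: oi; [exact: (congr1 fst E) | exact: (congr1 snd E)].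
Qed.

(** The strands cannot diverge in the next step: if [p] climbs and [q] descends, [hom_up_down] kills
    the coefficient, and the opposite divergence contradicts the order of their positions. *)
Lemma above_shift v : above v -> above (shift v).
Proof.
case: v => q p /andP[/= Fqp lt]; have lE := orb_lev Fqp.
have rE : rises (theta p) = rises (theta q).
  have [rp|rp] := boolP (rises (theta p)); have [rq|rq] := boolP (rises (theta q)) => //.
    by rewrite (hom_up_down l0 cE hf) ?up_orb ?eqxx // in Fqp.
  by have := falls_below lE rp rq; lia.
rewrite /above /= orb_same0 // Fqp !thetaS /=.
by have := advance_diff lE rE; lia.
Qed.

(** The argument of [above_shift] applied to the preceding step, with [hom_down_up], shows closure
    towards the past; finiteness turns it into closure towards the future. *)
Lemma below_shift v : below v -> below (shift v).
Proof.
apply: backward_closed shift_inj _ v => -[q p] /andP[/= Fqp]; rewrite !thetaS => lt.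
have lE := orb_lev Fqp; rewrite !thetaS in lE.
have rE : rises (theta p) = rises (theta q).
  have [rp|rp] := boolP (rises (theta p)); have [rq|rq] := boolP (rises (theta q)) => //.
    by have := advance_below (esym lE) rq rp; lia.
  by rewrite (hom_down_up l0 cE hf) ?up_orb ?eqxx // in Fqp.
have lE' : lev (theta p) = lev (theta q).
  move: lE; rewrite !lev_advance rE; case: ifP => [_ []//|/negbT rq].
  have := falls_gt0 rq; rewrite -rE in rq; have := falls_gt0 rq; lia.
rewrite orb_same0 // in Fqp; rewrite /below /= Fqp /=.
by have := advance_diff lE' rE; lia.
Qed.

Lemma hom_parallel (q : J) (p : I) : F q p != 0 -> theta q != theta p ->
  forall m, F (iter m (@ordS _) q) (iter m (@ordS _) p) != 0 /\
    rises (iter m adv (theta p)) = rises (iter m adv (theta q)).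
Proof.
move=> Fqp ne m; pose v := (q, p).
have N n : above (iter n shift v) || below (iter n shift v).
  elim: n => [|n /orP[/above_shift|/below_shift]] /=; last 2 first.
  - by move=> ->.
  - by move=> ->; rewrite orbT.
  rewrite /above /below /= Fqp /=.
  case: ltngtP => // E; case/eqP: ne; apply: strand_inj => //.
  by rewrite (orb_lev Fqp).
have vE n : iter n shift v = (iter n (@ordS _) q, iter n (@ordS _) p).
  by elim: n => //= n ->.
have Fn n : F (iter n (@ordS _) q) (iter n (@ordS _) p) != 0.
  by have := N n; rewrite vE => /orP[] /andP[].
split=> //; rewrite -!theta_iter.
have := orb_lev (Fn m); have := orb_lev (Fn m.+1); rewrite !iterS !thetaS !lev_advance.
by case: (rises _) (rises _) => [] [] // + E; rewrite E; lia.
Qed.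

Lemma hom_iter (q : J) (p : I) m : lev (theta p) = lev (theta q) ->
  (forall i, rises (iter i adv (theta p)) = rises (iter i adv (theta q))) ->
  (\prod_(i < m) bscalar l (iter i (@ordS _) p)) *
     F (iter m (@ordS _) q) (iter m (@ordS _) p) =
  (\prod_(i < m) bscalar l' (iter i (@ordS _) q)) * F q p.
Proof.
move=> lE rE; elim: m => [|m IH]; first by rewrite !big_ord0.
rewrite !big_ord_recr /= -mulrA orb_same; first by rewrite mulrCA IH mulrCA mulrA.
  by rewrite !theta_iter; have [] := iter_diff (n := m) lE (fun i _ => rE i).
by rewrite !theta_iter.
Qed.

(** Strands parallel for ever have the same period. After one period the coefficient returns to
    itself, multiplied by [l] on one side and by [l'] on the other. *)
Lemma hom_orb (q : J) (p : I) : F q p != 0 -> theta q != theta p -> l = l'.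
Proof.
move=> Fqp ne; have lE := orb_lev Fqp; have par := hom_parallel Fqp ne.
have rE i := (par i).2.
have per n : (iter n adv (theta p) = theta p) <-> (iter n adv (theta q) = theta q).
  have [l1 p1] := iter_diff (n := n) lE (fun i _ => rE i).
  split=> E; rewrite E in l1 p1; apply: strand_inj; rewrite ?l1 -?l1 -?lE //; lia.
have perE n : (size (bwalk (orb a)) %| n)%N <-> (size (bwalk (orb b)) %| n)%N.
  rewrite -(iter_ordS_dvd p) -(iter_ordS_dvd q).
  split=> /(congr1 (@theta _ _ _ _)); rewrite theta_iter => E;
    apply: theta_inj; rewrite theta_iter; exact/per.
have sE : size (bwalk (orb a)) = size (bwalk (orb b)).
  by apply/eqP; rewrite eqn_dvd; apply/andP; split; apply/perE.
have := hom_iter (size (bwalk (orb a))) lE rE.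
have -> : \prod_(i < size (bwalk (orb a))) bscalar l' (iter i (@ordS _) q) = l'.
  by rewrite sE prod_bscalar.
rewrite prod_bscalar.
have /iter_ordS_dvd -> := dvdnn (size (bwalk (orb a))).
have -> : iter (size (bwalk (orb a))) (@ordS _) q = q.
  by apply/iter_ordS_dvd; rewrite sE.
by move/(mulIf Fqp).
Qed.

Lemma hom_orb0 : l != l' -> ~~ fconnect adv a b -> f = 0.
Proof.
move=> ll ab; apply/matrixP=> i j; rewrite mxE.
rewrite -(enum_valK i) -(enum_valK j) -[LHS]/(F (enum_val i) (enum_val j)).
apply/eqP; apply: contraNT ll => Fne; apply/eqP/(hom_orb Fne).
apply: contraNneq ab => E; apply: connect_trans (theta_connect (enum_val j)) _.
rewrite -E fconnect_sym ?theta_connect //; exact: advance_inj.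
Qed.
End OrbitHoms.

(** An entry off the diagonal would make two distinct strands of one orbit parallel, against
    [parallel_eq]; the diagonal entries are constant along the band by [orb_same]. *)
Lemma orb_brick (k : fieldType) x y w (a : strand x y w) (l : k) : l != 0 ->
  brick (band_mod (orb a) l).
Proof.
move=> l0; split.
  by rewrite -[mdim _]/(#|'I_(size (bwalk (orb a)))|) card_ord; apply: band_size.
move=> f hf; pose F := @hcoef k (orb a) (orb a) l l f.
have diag q p : q != p -> F q p = 0.
  move=> qp; apply/eqP; apply: contraNT qp => Fqp.
  have [/theta_inj ->//|ne] := eqVneq (theta q) (theta p).
  have [n En] : exists n, theta q = iter n (@advance x y w) (theta p).
    have /iter_findex <- : fconnect (@advance x y w) (theta p) (theta q).
      apply: connect_trans (theta_connect q).
      by rewrite fconnect_sym ?theta_connect //; apply: advance_inj.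
    by exists (findex (@advance x y w) (theta p) (theta q)).
  have par := hom_parallel l0 l0 hf Fqp ne.
  case/eqP: ne; rewrite En; apply: parallel_eq; rewrite -En.
    exact: orb_lev hf _ _ Fqp.
  by move=> m; case: (par m).
have step p : F (ordS p) (ordS p) = F p p.
  have := orb_same l0 l0 hf (q := p) (p := p) erefl erefl.
  by move/(mulfI (bscalar_neq0 p l0)).
have r0 := band_size (orb a); pose t0 := Ordinal r0.
have const n (ln : (n < size (bwalk (orb a)))%N) : F (Ordinal ln) (Ordinal ln) = F t0 t0.
  elim: n ln => [|n IH] ln; first by congr F; apply: val_inj.
  rewrite -(IH (ltnW ln)) -(step (Ordinal (ltnW ln))).
  by congr F; apply: val_inj; rewrite /= modn_small.
exists (F t0 t0); apply/matrixP=> i j; rewrite mxE.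
rewrite -[in LHS](enum_valK i) -[in LHS](enum_valK j) -[LHS]/(F (enum_val i) (enum_val j)).
have [->|ij] := eqVneq i j; last by rewrite diag // (inj_eq enum_val_inj).
by case: (enum_val j) => n ln; rewrite const.
Qed.

(** A root of [p + 1], where [p] vanishes at 0 and at the elements found so far, is new. *)
Lemma distinct_nonzero (k : closedFieldType) n :
  exists s : seq k, [/\ size s = n, uniq s & 0 \notin s].
Proof.
elim: n => [|n [s [sz us s0]]]; first by exists [::].
pose p : {poly k} := \prod_(c <- 0 :: s) ('X - c%:P).
have szp : size p = (size s).+2 by rewrite size_prod_XsubC.
have : size (p + 1) != 1 by rewrite size_polyDl szp // size_poly1.
case/closed_rootP => c; rewrite rootE hornerD hornerC => /eqP pc.
have : ~~ root p c.
  apply/negP => /rootP E; move: pc; rewrite E add0r => /eqP.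
  by rewrite oner_eq0.
rewrite root_prod_XsubC inE negb_or => /andP[c0 cs].
exists (c :: s); split; first by rewrite /= sz.
  by rewrite /= cs us.
by rewrite inE negb_or eq_sym c0 s0.
Qed.

(** * Climbs of the closed curves and existence of semibricks *)

Section Counting.
Variables x y w : nat.
Local Notation strand := (strand x y w).
Local Notation adv := (@advance x y w).
Implicit Types p q : strand.
Local Open Scope nat_scope.

Lemma adv_sym : connect_sym (frel adv).
Proof. exact: fconnect_sym (@advance_inj x y w). Qed.

Lemma card_rising i : i < 4 -> #|[pred q : strand | rises q & lev q == i]| = edges x y w i.+1.
Proof.
move=> i4; rewrite -[RHS]card_ord.
have /fin_all_exists[g Eg] : forall j : 'I_(edges x y w i.+1),
    exists q : strand, lev q = i /\ pos q = edges x y w i + j.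
  by move=> j; apply: strand_ex => //; rewrite ltn_add2l.
have gi : injective g.
  move=> j j' E; have [_] := Eg j; have [_] := Eg j'; rewrite E => -> /addnI E'.
  by apply: val_inj.
rewrite -(card_codom gi); apply: eq_card => q; rewrite !inE; apply/andP/codomP.
  case=> rq /eqP lq; have := pos_lt q; move: (rq); rewrite /rises lq => ge lt.
  have lt' : pos q - edges x y w i < edges x y w i.+1 by lia.
  exists (Ordinal lt'); have [l1 p1] := Eg (Ordinal lt').
  by apply: strand_inj; rewrite ?l1 ?p1 //= subnKC.
case=> j ->; have [l1 p1] := Eg j; rewrite /rises l1 p1 eqxx.
by split=> //; apply: leq_addr.
Qed.

Lemma nup_orb p i :
  nup (orb p) i = #|[pred q : strand | fconnect adv p q & rises q && (lev q == i)]|.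
Proof.
rewrite /nup -(card_image (@theta_inj x y w p)); apply: eq_card => q.
apply/imageP/idP => [[t]|]; rewrite !inE.
  by rewrite up_orb bheight_orb => /andP[rt lt] ->; rewrite rt lt theta_connect.
case/andP=> /theta_surj[t <-] Ht; exists t => //.
by rewrite inE up_orb bheight_orb.
Qed.

Definition reps : seq strand := enum (froots adv).

Lemma sum_nup_reps i : i < 4 -> \sum_(p <- reps) nup (orb p) i = edges x y w i.+1.
Proof.
move=> i4; rewrite -card_rising // -sum1_card.
rewrite [RHS](partition_big (froot adv) (froots adv)) => [|q _]; last exact: roots_root adv_sym _.
rewrite /reps big_enum /=; apply: eq_bigr => p rp.
rewrite nup_orb -sum1_card; apply: eq_bigl => q; rewrite !inE.
rewrite andbC; congr (_ && _).
by rewrite -(root_connect adv_sym) (eqP rp) eq_sym.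
Qed.

Lemma reps_connect p q : p \in reps -> q \in reps -> fconnect adv p q -> p = q.
Proof.
rewrite !mem_enum => rp rq; rewrite -(root_connect adv_sym) => /eqP.
by rewrite (eqP rp) (eqP rq).
Qed.

Lemma nup_transitive p : (forall q, fconnect adv p q) ->
  forall i, i < 4 -> nup (orb p) i = edges x y w i.+1.
Proof.
move=> tr i i4; rewrite nup_orb -card_rising //; apply: eq_card => q.
by rewrite !inE tr.
Qed.
End Counting.

(** All closed curves of the diagram are taken once, with pairwise distinct parameters, so that
    [hom_orb0] applies to any two of them. *)
Lemma semibrick_exists (k : closedFieldType) x y w :
  exists S : lmodule4 k, band_semibrick S /\ is_gvector S (gtuple x y w).
Proof.
have [ls [sz us l0]] := distinct_nonzero k (size (reps x y w)).
pose s := [seq (orb p.1, p.2) | p <- zip (reps x y w) ls].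
pose ms := [seq @band_mod k p.1 p.2 | p <- s].
have ms_size : size ms = size ls by rewrite !size_map size2_zip ?sz.
have ms_nth p0 i : (i < size ms)%N ->
    nth (zero_mod k) ms i = band_mod (orb (nth p0 (reps x y w) i)) (nth 0 ls i).
  rewrite ms_size => lt; rewrite /ms /s -map_comp (nth_map (p0, 0)) ?size2_zip ?sz //=.
    by rewrite nth_zip.
  by rewrite -sz.
have l_neq0 i : (i < size ms)%N -> nth 0 ls i != 0.
  by rewrite ms_size => /(mem_nth 0) H; apply: contraNneq l0 => <-.
have inh i : (i < size ms)%N -> exists p0 : strand x y w, True.
  by rewrite ms_size sz; case: (reps x y w) => [|p0 r] // _; exists p0.
exists (dsums ms); split.
  exists ms; split=> // [i lt|i j lti ltj ij f].
    have [p0 _] := inh i lt.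
    rewrite (ms_nth p0) //; split; last exact/orb_brick/l_neq0.
    by exists (orb (nth p0 (reps x y w) i)), (nth 0 ls i); split=> //; apply: l_neq0.
  have [p0 _] := inh i lti.
  move: f; rewrite !(ms_nth p0) // => f hf.
  apply: (hom_orb0 (l_neq0 _ lti) (l_neq0 _ ltj) hf); rewrite ms_size sz in lti ltj.
    by rewrite nth_uniq ?sz.
  apply: contra ij => /reps_connect E.
  by rewrite -(nth_uniq p0 lti ltj (enum_uniq (froots _))) E ?mem_nth.
have E i : (i < 4)%N -> (\sum_(p <- s) nup p.1 i)%N = edges x y w i.+1.
  move=> i4; rewrite -sum_nup_reps // /s big_map -(big_map fst xpredT (fun p => nup (orb p) i)).
  by rewrite -/(unzip1 _) unzip1_zip ?sz.
have := @bands_gvector k s; rewrite !E //; apply.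
move=> p; rewrite -map_comp => /mapP[q /(map_f snd) ql ->] /=.
by apply: contraNneq l0 => <-; rewrite -/(unzip2 _) unzip2_zip ?sz // in ql.
Qed.

(** * Connectedness of the diagram *)

Section Transitivity.
Variables x y w : nat.
Local Notation strand := (strand x y w).
Local Notation adv := (@advance x y w).
Implicit Types p q r : strand.
Local Open Scope nat_scope.
Hypothesis y0 : 0 < y.

Let conn_sym p q : fconnect adv p q = fconnect adv q p.
Proof. exact: adv_sym. Qed.

(* Every strand is connected to the strand at level 1 whose position is congruent
   to its own and smaller than y. *)
Definition linked q n : Prop := forall r, lev r = 1 -> pos r = n %% y -> fconnect adv r q.

Lemma linked_adv q n : linked (adv q) n -> linked q n.
Proof.
move=> H r r1 rn; apply: connect_trans (H r r1 rn) _.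
by rewrite conn_sym fconnect1.
Qed.

Lemma linked_advI q n : linked q n -> linked (adv q) n.
Proof. by move=> H r r1 rn; apply: connect_trans (H r r1 rn) (fconnect1 _ _). Qed.

Lemma linked_mod q n m : n = m %[mod y] -> linked q n -> linked q m.
Proof. by rewrite /linked => ->. Qed.

(** The excursion from level 1 to level 0 and back adds [y] to the position. *)
Lemma linked1 q : lev q = 1 -> linked q (pos q).
Proof.
move: {2}(pos q) (erefl (pos q)) => n.
elim/ltn_ind: n q => n IH q qn q1.
have [lt|ge] := ltnP (pos q) y.
  move=> r r1; rewrite modn_small // => rn.
  by rewrite (@strand_inj _ _ _ r q) ?r1 ?q1 // connect0.
have qlt := pos_lt q; rewrite q1 /edges /= in qlt.
have [||r [r1 rp]] := @strand_ex x y w 1 (pos q - y) => //.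
  by rewrite /edges /=; lia.
have fr : ~~ rises r by rewrite /rises r1 rp /edges /=; lia.
pose r' := adv r.
have r'1 : lev r' = 0 by rewrite lev_advance (negbTE fr) r1.
have r'p : pos r' = pos q - y by rewrite pos_advance (negbTE fr).
have rr' : rises r' by rewrite /rises r'1.
have qE : q = adv r'.
  apply: strand_inj; first by rewrite lev_advance rr' r'1 q1.
  by rewrite pos_advance rr' r'1 r'p /edges /=; lia.
rewrite qE; do 2 apply: linked_advI.
apply: (@linked_mod _ (pos r)); last by apply: (IH (pos r)) => //; lia.
by rewrite -qE rp -[in RHS](subnK ge) modnDr.
Qed.

(** The excursion from level 2 to level 3 and back subtracts [y]; positions smaller than [y] descend
    unchanged to level 1. *)
Lemma linked2 q : lev q = 2 -> linked q (pos q).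
Proof.
move: {2}(pos q) (erefl (pos q)) => n.
elim/ltn_ind: n q => n IH q qn q2.
have [lt|ge] := ltnP (pos q) y.
  have fq : ~~ rises q by rewrite /rises q2 /edges /=; lia.
  apply: linked_adv; have := @linked1 (adv q).
  by rewrite lev_advance pos_advance (negbTE fq) q2; apply.
have qlt := pos_lt q; rewrite q2 /edges /= in qlt.
have rq : rises q by rewrite /rises q2 /edges /=; lia.
pose r := adv q.
have r3 : lev r = 3 by rewrite lev_advance rq q2.
have rp : pos r = pos q - y by rewrite pos_advance rq q2 /edges /=; lia.
have fr : ~~ rises r by rewrite /rises r3 rp /edges /=; lia.
have l2 : lev (adv r) = 2 by rewrite lev_advance (negbTE fr) r3.
have p2 : pos (adv r) = pos q - y by rewrite pos_advance (negbTE fr).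
do 2 apply: linked_adv; apply: (@linked_mod _ (pos (adv r))).
  by rewrite p2 -[in RHS](subnK ge) modnDr.
by apply: (IH (pos (adv r))) => //; lia.
Qed.

Lemma linked_ex q : exists n, linked q n.
Proof.
have := lev_lt4 q; case E: (lev q) => [|[|[|[|n]]]] // _.
- have rq : rises q by rewrite /rises E.
  exists (pos (adv q)); apply/linked_adv/linked1.
  by rewrite lev_advance rq E.
- by exists (pos q); apply: linked1.
- by exists (pos q); apply: linked2.
have fq : ~~ rises q by apply/negP => /rises_lt3; rewrite E.
exists (pos (adv q)); apply/linked_adv/linked2.
by rewrite lev_advance (negbTE fq) E.
Qed.

Definition joined n m : Prop := forall p q, lev p = 1 -> lev q = 1 ->
  pos p = n %% y -> pos q = m %% y -> fconnect adv p q.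

Lemma level1_ex n : exists p, lev p = 1 /\ pos p = n %% y.
Proof. by apply: strand_ex => //; rewrite /edges /=; have := ltn_pmod n y0; lia. Qed.

Lemma joined_trans n m l : joined n m -> joined m l -> joined n l.
Proof.
move=> H1 H2 p q p1 q1 pn ql; have [r [r1 rm]] := level1_ex m.
exact: connect_trans (H1 p r p1 r1 pn rm) (H2 r q r1 q1 rm ql).
Qed.

(** The climb from level 1 to level 2 is the translation by [w - x]. Modulo [y] this is the stated
    number, which avoids subtraction; its last term [y] makes it positive, as Bezout's identity will
    require. *)
Lemma joined_shift n : joined n (n + (w + x * y.-1 + y)).
Proof.
(* Exactly the positions from [x] to [x + y - 1] climb from level 1, and they represent all residues
   modulo [y]. *)
have [i [ni xi iy]] : exists i, [/\ i = n %[mod y], x <= i & i < x + y].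
  exists (x + (n + x * y.-1) %% y); split; rewrite ?leq_addr ?ltn_add2l ?ltn_pmod //.
  rewrite modnDmr addnCA -{1}[x]muln1 -mulnDr add1n prednK // addnC.
  by rewrite modnMDl.
have [||r [r1 ri]] := @strand_ex x y w 1 i => //.
have rr : rises r by rewrite /rises r1 ri /edges /=.
have l2 : lev (adv r) = 2 by rewrite lev_advance rr r1.
have p2 : pos (adv r) = i + w - x by rewrite pos_advance rr r1 ri /edges /=; lia.
move=> p q p1 q1 pn qn.
have H1 : fconnect adv p r by apply: (linked1 r1) => //; rewrite pn ri ni.
have H2 : fconnect adv q (adv r).
  apply: (linked2 l2) => //; rewrite qn p2.
  have -> : n + (w + x * y.-1 + y) = n + (w + x * y.-1) + y by rewrite addnA.
  rewrite modnDr -modnDml -ni modnDml.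
  have : i + (w + x * y.-1) + y = (i + w - x) + (x.+1 * y).
    by case: (y) y0 => //= y' _; rewrite mulnS mulSn; nia.
  by move/(congr1 (fun m => m %% y)); rewrite modnDr [in RHS]addnC modnMDl.
apply: connect_trans H1 _; apply: connect_trans (fconnect1 _ _) _.
by rewrite conn_sym.
Qed.

Lemma strands_connected : coprime (w + x * y.-1 + y) y ->
  exists p, forall q, fconnect adv p q.
Proof.
set d := w + _ + _ => co; have d0 : 0 < d by rewrite /d addn_gt0 y0 orbT.
have J j : joined 0 (j * d).
  elim: j => [|j IH].
    by move=> p q p1 q1 p0 q0; rewrite (@strand_inj _ _ _ p q) ?connect0 ?p1 ?p0.
  by apply: joined_trans IH _; rewrite mulSn addnC; apply: joined_shift.
have [p [p1 p0]] := level1_ex 0; exists p => q.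
have [n nq] := linked_ex q; have [r [r1 rn]] := level1_ex n.
(* The first Bezout coefficient inverts [d] modulo [y], so [n] times this many shifts lead from 0 to
   [n]. *)
apply: connect_trans (nq r r1 rn); apply: (J (n * (egcdn d y).1)) => //.
rewrite rn -mulnA; case: egcdnP => // u v E _ /=.
by rewrite E (eqP co) mulnDr muln1 mulnA modnMDl.
Qed.
End Transitivity.

(** * Band bricks are strand diagrams *)

Section Aperiodic.
Variable z : band.
Local Notation r := (size (bwalk z)).
Local Notation S := (@ordS r).
Implicit Types p q t : 'I_r.
Local Open Scope nat_scope.

Lemma iter_up_height p q n : bheight p = bheight q ->
  (forall i, i < n -> up (iter i S p) = up (iter i S q)) ->
  bheight (iter n S p) = bheight (iter n S q).
Proof.
move=> hE; elim: n => [//|n IH] uE; rewrite !iterS !up_height.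
by rewrite IH ?uE // => i lt; apply/uE/ltnW.
Qed.

Lemma iter_between p q : exists n, iter n S p = q.
Proof.
exists (q + r - p); apply: val_inj; rewrite /= val_iter_ordS.
by rewrite subnKC ?modnDr ?modn_small //; have := ltn_ord p; lia.
Qed.

(** The gcd of [d] with the length is again a period; if it were smaller than the length, the walk
    would be a proper power of its initial segment of that size. *)
Lemma no_period d : (forall t, bletter (iter d S t) = bletter t) -> r %| d.
Proof.
move=> per; have r0 := band_size z; case: (posnP d) => [->|d0]; first exact: dvdn0.
have perM j t : bletter (iter (j * d) S t) = bletter t.
  by elim: j => [//|j IH]; rewrite mulSn iterD per.
set g := gcdn d r; have perg t : bletter (iter g S t) = bletter t.
  case: (egcdnP r d0) => u v E _; rewrite -(perM u t) E addnC iterD.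
  by have /iter_ordS_dvd -> := dvdn_mull v (dvdnn r).
have perMg j t : bletter (iter (j * g) S t) = bletter t.
  by elim: j => [//|j IH]; rewrite mulSn iterD perg.
have gr : g %| r by apply: dvdn_gcdr.
have g0 : 0 < g by rewrite gcdn_gt0 d0.
have [gE|gE] := eqVneq g r; first by rewrite -gE dvdn_gcdl.
have gl : g < r by rewrite ltn_neqAle gE dvdn_leq.
have [zs _ prim _] := bwalkP z; exfalso.
apply: (prim (take g (bwalk z)) (r %/ g)).
- apply: take_sorted; move: zs; apply: sub_sorted => a b.
  by case/and4P.
- by rewrite ltn_divRL // mul1n.
have szt : size (take g (bwalk z)) = g by rewrite size_takel // ltnW.
have t0 : 'I_r := Ordinal r0; pose l0 := bletter t0.
apply: (@eq_from_nth _ l0).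
  by rewrite size_flatten /shape map_nseq sumn_nseq szt mulnC divnK.
move=> i ir; rewrite nth_walk_pow szt ?divnK // nth_take ?ltn_mod //.
have ig : i %% g < r by apply: leq_ltn_trans ir; apply: leq_mod.
have bE n (ln : n < r) : nth l0 (bwalk z) n = bletter (Ordinal ln).
  by rewrite /bletter (tnth_nth l0).
rewrite (bE _ ir) (bE _ ig) -[RHS](perMg (i %/ g)); congr bletter.
apply: val_inj; rewrite /= val_iter_ordS /= addnC -divn_eq modn_small //.
Qed.

Lemma band_aperiodic p q : bheight p = bheight q ->
  (forall m, up (iter m S p) = up (iter m S q)) -> p = q.
Proof.
move=> hE uE; have [d qE] := iter_between p q.
have /iter_ordS_dvd E : r %| d.
  apply: no_period => t; have [m <-] := iter_between p t.
  rewrite -iterD addnC iterD qE; symmetry; apply: bletter_same => //.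
  by apply: iter_up_height.
by rewrite -qE E.
Qed.

(* The cyclic word of the directions read from p, as a binary number with r digits:
   this orders the positions at a given height lexicographically. *)
Definition binary n (u : nat -> bool) : nat := \sum_(i < n) u i * 2 ^ (n.-1 - i).

Lemma binaryS n u : binary n.+1 u = u 0 * 2 ^ n + binary n (fun i => u i.+1).
Proof.
rewrite /binary big_ord_recl /= subn0; congr (_ + _).
by apply: eq_bigr => i _; congr (_ * 2 ^ _); rewrite /bump /=; have := ltn_ord i; lia.
Qed.

(** Doubling moves the leading digit to weight [2 ^ n]; the rotated word has it at weight 1
    instead. *)
Lemma binary_shift n u : 0 < n -> u n = u 0 ->
  binary n (fun i => u i.+1) + u 0 * (2 ^ n).-1 = 2 * binary n u.
Proof.
case: n => // n _ un; rewrite [in RHS]binaryS mulnDr.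
have -> : binary n.+1 (fun i => u i.+1) = 2 * binary n (fun i => u i.+1) + u 0.
  rewrite /binary big_ord_recr /= subnn muln1 un big_distrr /=; congr (_ + _).
  apply: eq_bigr => i _; rewrite mulnCA -expnS; congr (_ * 2 ^ _).
  by have := ltn_ord i; lia.
have := expn_gt0 2 n; rewrite expnS; case: (u 0) => /=; lia.
Qed.

Lemma binary_lt n u : binary n u < 2 ^ n.
Proof.
elim: n u => [|n IH] u; first by rewrite /binary big_ord0.
by have := IH (fun i => u i.+1); rewrite binaryS expnS; case: (u 0) => /=; lia.
Qed.

Definition word p : nat := binary r (fun i => up (iter i S p)).

Lemma wordS p : word (S p) + up p * (2 ^ r).-1 = 2 * word p.
Proof.
rewrite /word -(binary_shift (u := fun i => up (iter i S p))) //=.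
- by congr (_ + _); apply: eq_bigr => i _; rewrite -iterSr.
- exact: band_size.
by have /iter_ordS_dvd -> := dvdnn r.
Qed.

Lemma word_same p q : up p = up q -> (word (S p) < word (S q)) = (word p < word q).
Proof. by move=> uE; have := wordS p; have := wordS q; rewrite uE; lia. Qed.

Lemma word_down_up p q : ~~ up p -> up q -> word p < word q.
Proof.
move=> up_p up_q; have := wordS p; have := wordS q; rewrite up_q (negbTE up_p).
have := binary_lt r (fun i => up (iter i S (S p))); rewrite -/(word (S p)).
have := expn_gt0 2 r.-1; have : 2 ^ r = 2 * 2 ^ r.-1 by rewrite -expnS prednK ?band_size.
by move: (2 ^ r) (2 ^ r.-1) => a b ->; lia.
Qed.

Lemma word_up p q : word p = word q -> up p = up q.
Proof.
have [a|a] := boolP (up p); have [b|b] := boolP (up q) => // E.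
  by have := word_down_up b a; rewrite E ltnn.
by have := word_down_up a b; rewrite E ltnn.
Qed.

Lemma word_inj p q : bheight p = bheight q -> word p = word q -> p = q.
Proof.
move=> hE wE; apply: band_aperiodic => // m; apply: word_up.
elim: m => [//|m IH]; rewrite !iterS.
have := wordS (iter m S p); have := wordS (iter m S q).
by rewrite (word_up IH) IH; lia.
Qed.

Lemma word_divergence p q : word p < word q -> exists m,
  [/\ forall i, i < m -> up (iter i S p) = up (iter i S q),
      ~~ up (iter m S p) & up (iter m S q)].
Proof.
move=> lt; have ex : exists m, up (iter m S p) != up (iter m S q).
  have [/existsP[i Hi]|/existsPn H] :=
    boolP [exists i : 'I_r, up (iter i S p) != up (iter i S q)]; first by exists i.
  suff E : word p = word q by rewrite E ltnn in lt.
  by apply: eq_bigr => i _; rewrite (eqP (negPn (H i))).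
case: (ex_minnP ex) => m ne min; exists m.
have same i : i < m -> up (iter i S p) = up (iter i S q).
  by move=> im; apply/eqP; apply: contraTT im => /min; rewrite -leqNgt.
have ltm : word (iter m S p) < word (iter m S q).
  elim: (m) same => [//|n IH] same; rewrite !iterS word_same ?same //.
  by apply: IH => i im; apply/same/ltnW.
split=> //; move: ne; have [a|a] := boolP (up (iter m S p));
  have [b|b] := boolP (up (iter m S q)) => // _.
all: by have := word_down_up b a; rewrite ltnNge ltnW.
Qed.

Lemma sum_ordS (F : 'I_r -> nat) : \sum_t F (S t) = \sum_t F t.
Proof. by rewrite [RHS](reindex_inj (bij_inj (ordS_bij r))). Qed.

(** The place of [p] in the lexicographic order at its height. For a band brick it plays the role of
    [pos] in a strand diagram, and [ndown] that of [edges]. *)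
Definition rank p : nat := \sum_(q : 'I_r) ((bheight q == bheight p) && (word q < word p)).
Definition ndown h : nat := \sum_(q : 'I_r) (~~ up q && (bheight q == h)).

Lemma nup_sum h : nup z h = \sum_(q : 'I_r) (up q && (bheight q == h)).
Proof. by rewrite /nup -sum1_card big_mkcond; apply: eq_bigr => q _; rewrite inE; case: (_ && _). Qed.

(** By induction on the height: the positions at a height are counted once by the steps which leave
    it and once by those which arrive. *)
Lemma ndownS h : ndown h.+1 = nup z h.
Proof.
have E : forall h, \sum_(q : 'I_r) (bheight q == h : nat) = ndown h + nup z h.
  move=> h'; rewrite nup_sum /ndown -big_split; apply: eq_bigr => q _ /=.
  by case: (up q) (_ == _) => [] [].
have E0 : ndown 0 = 0.
  by apply: big1 => q _; have [//|/down_height_gt0] := boolP (up q); case: (bheight q).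
elim: h => [|h IH].
  have := E 0; rewrite -sum_ordS E0 add0n => <-.
  apply: eq_bigr => q _; rewrite up_height; have [|/down_height_gt0] := boolP (up q) => //=.
  by case: (bheight q) => // n _; rewrite eqSS.
have := E h.+1; rewrite IH -sum_ordS.
have -> : \sum_(q : 'I_r) (bheight (S q) == h.+1 : nat) = ndown h.+2 + nup z h.
  rewrite nup_sum /ndown -big_split; apply: eq_bigr => q _ /=.
  rewrite up_height; have [|/down_height_gt0] := boolP (up q) => //=.
  by case: (bheight q) => // n _; rewrite addn0 eqSS.
lia.
Qed.

(** * Ranks along a band brick *)

Section Brick.
Variable k : fieldType.
Hypothesis zb : brick (band_mod z (1 : k)).

(* Otherwise the strings following S p and S q carry an endomorphism which is not scalar. *)
Lemma brick_below p q : bheight (S p) = bheight (S q) -> ~~ up p -> up q ->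
  word (S p) < word (S q).
Proof.
move=> hE up_p up_q; rewrite ltnNge; apply/negP => le.
have ne : S q != S p.
  by apply/eqP => /(bij_inj (ordS_bij r)) E; rewrite -E up_q in up_p.
have lt : word (S q) < word (S p).
  by rewrite ltn_neqAle le andbT; apply: contra ne => /eqP E; apply/eqP/word_inj.
have [m [same dn_m up_m]] := word_divergence lt.
pose a0 := S q; pose b0 := S p.
(* The relation pairs simultaneous positions of the two strands until they diverge. At its start [q]
   climbs and [p] descends, at its end the source descends and the target climbs; both are permitted
   by [hom_criterion]. *)
pose R (b a : 'I_r) := [exists n : 'I_m.+1, (a == iter n S a0) && (b == iter n S b0)].
have RP b a : reflect (exists2 n, n <= m & a = iter n S a0 /\ b = iter n S b0) (R b a).
  apply: (iffP existsP) => [[n /andP[/eqP-> /eqP->]]|[n nm [-> ->]]].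
    by exists n; rewrite // -ltnS.
  by exists (Ordinal (nm : n < m.+1)); rewrite /= !eqxx.
pose f : 'M[k]_(mdim (band_mod z (1 : k))) :=
  (\matrix_(i, j) (R (enum_val i) (enum_val j))%:R)%R.
have fE b a : @hcoef k z z 1 1 f b a = ((R b a)%:R)%R.
  by rewrite /hcoef mxE !enum_rankK.
have R_height b a : R b a -> bheight a = bheight b.
  case/RP=> n nm [-> ->]; apply: iter_up_height => // i ni; apply: same.
  exact: leq_trans ni nm.
have R_same b a : up a = up b -> R (S b) (S a) = R b a.
  move=> uE; apply/RP/RP => -[n nm [aE bE]].
    case: n nm aE bE => [|n] nm aE bE.
      have aq : a = q by apply: (bij_inj (ordS_bij r)).
      have bp : b = p by apply: (bij_inj (ordS_bij r)).
      by move: up_p; rewrite -bp -uE aq up_q.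
    exists n; first exact: ltnW.
    by rewrite iterS in aE bE; split; apply: (bij_inj (ordS_bij r)).
  have nm' : n < m.
    rewrite ltn_neqAle nm andbT; apply/eqP => E; rewrite E in aE bE.
    by move: dn_m; rewrite -/a0 -aE uE bE up_m.
  by exists n.+1 => //; rewrite !iterS aE bE.
have hf : @is_hom k (band_mod z 1%R) (band_mod z 1%R) f.
  apply: (@hom_criterion _ _ _ _ _ (oner_neq0 k) (oner_neq0 k) erefl) => b a.
  - rewrite fE; case: (boolP (R b a)) => [/R_height//|_].
    by rewrite eqxx.
  - move=> _ uE; rewrite !fE R_same // /bscalar; do 2 case: ifP => _; by rewrite !GRing.mul1r.
  - move=> ua ub; rewrite fE; case: RP => // -[n nm [aE bE]].
    move: nm; rewrite leq_eqVlt => /orP[/eqP E|/same E].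
      by move: dn_m; rewrite -E -/a0 -aE ua.
    by move: ub; rewrite bE -E -/a0 -aE ua.
  - move=> ua ub; rewrite fE; case: RP => // -[n nm [aE bE]].
    case: n nm aE bE => [|n] nm aE bE.
      by move: ua; rewrite (bij_inj (ordS_bij r) aE) up_q.
    rewrite iterS in aE bE.
    move: ua ub; rewrite (bij_inj (ordS_bij r) aE) (bij_inj (ordS_bij r) bE).
    by rewrite same // => /negP.
have [_ /(_ f hf)[c fc]] := zb.
have := fE (S p) (S q); rewrite /hcoef fc mxE.
have -> : R (S p) (S q) by apply/RP; exists 0.
rewrite (inj_eq enum_rank_inj) eq_sym (negbTE ne) mulr0n => /eqP.
by rewrite eq_sym oner_eq0.
Qed.

(** A smaller position also descends, a larger one that descends stays larger, and by [brick_below]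
    the positions which arrive from below come after. *)
Lemma rank_down p : ~~ up p -> rank (S p) = rank p.
Proof.
move=> up_p; rewrite /rank -sum_ordS; apply: eq_bigr => q _; congr nat_of_bool.
have hp := down_height_gt0 up_p; rewrite !up_height (negbTE up_p).
have [up_q|up_q] := boolP (up q).
  have := word_down_up up_p up_q => /ltnW; rewrite leqNgt => /negbTE ->; rewrite andbF.
  case: eqP => //= hE; apply/negbTE; rewrite -leqNgt ltnW // brick_below //.
  by rewrite !up_height up_q (negbTE up_p).
rewrite word_same ?(negbTE up_p) ?(negbTE up_q) //; congr (_ && _).
have := down_height_gt0 up_q; lia.
Qed.

(** The rule of [pos_advance]: the descending positions, all smaller, are lost, and those which
    arrive from above are all smaller. *)
Lemma rank_up p : up p ->
  rank (S p) + ndown (bheight p) = rank p + ndown (bheight p).+2.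
Proof.
move=> up_p; rewrite /rank /ndown -sum_ordS -!big_split; apply: eq_bigr => q _ /=.
rewrite !up_height up_p; have [up_q|up_q] := boolP (up q) => /=.
  by rewrite word_same ?up_p ?up_q // eqSS !addn0.
rewrite (word_down_up up_q up_p) andbT addnC; congr (_ + _).
have := down_height_gt0 up_q; case hq: (bheight q) => [//|h] _ /=; rewrite eqSS.
case: eqP => //= hE; rewrite brick_below // !up_height up_p (negbTE up_q) hq /= hE //.
Qed.

(** Climbs from heights 0, 1 and 2 change the rank by [nup z 1], by [nup z 2 - nup z 0] and by
    [- nup z 1], all divisible by [g]. *)
Lemma rank_const g p q : g %| nup z 1 -> nup z 0 = nup z 2 %[mod g] ->
  rank p = rank q %[mod g].
Proof.
move=> g1 g02; have d0 : ndown 0 = 0.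
  by apply: big1 => t _; have [//|/down_height_gt0] := boolP (up t); case: (bheight t).
have step t : rank (S t) = rank t %[mod g].
  have [ut|/rank_down -> //] := boolP (up t).
  have := rank_up ut; have := up_height_lt3 ut; case: (bheight t) => [|[|[|h]]] // _.
  - rewrite d0 ndownS addn0 => ->.
    by rewrite -modnDmr (eqP g1) addn0.
  - rewrite !ndownS => E; apply/eqP; rewrite -(eqn_modDr (nup z 0)) E.
    by rewrite eqn_modDl; apply/eqP.
  - rewrite !ndownS nup3 addn0 => <-; by rewrite -modnDmr (eqP g1) addn0.
have [n <-] := iter_between p q.
by elim: n => [//|n IH]; rewrite iterS step.
Qed.

(** If [g > 1], at least two positions have height 1; the two smallest words there have ranks 0 and
    1, which are not congruent modulo [g]. *)
Lemma brick_coprime g : 0 < nup z 1 -> g %| nup z 1 -> nup z 0 = nup z 2 %[mod g] -> g = 1.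
Proof.
move=> y0 g1 g02; have g0 : 0 < g by apply: dvdn_gt0 g1.
apply/eqP; rewrite eqn_leq g0 andbT leqNgt; apply/negP => g2.
have : 1 < nup z 1 by apply: leq_trans g2 (dvdn_leq _ g1).
case/card_gt1P => s [t [hs ht st]].
have {}hs : bheight s == 1 by move: hs; rewrite inE => /andP[].
have {}ht : bheight t == 1 by move: ht; rewrite inE => /andP[].
case: (@arg_minnP _ s (fun q => bheight q == 1) word hs) => p hp minp.
have [t' ht' tp] : exists2 t', bheight t' == 1 & t' != p.
  by case: (eqVneq s p) => [E|]; [exists t; rewrite // -E eq_sym | exists s].
have H0 : (bheight t' == 1) && (t' != p) by rewrite ht'.
case: (@arg_minnP _ t' (fun q => (bheight q == 1) && (q != p)) word H0).
move=> p' /andP[hp' pp'] minp'.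
have rp : rank p = 0.
  apply: big1 => q _; rewrite (eqP hp); case: (boolP (bheight q == 1)) => //= hq.
  by rewrite ltnNge minp.
have rp' : rank p' = 1.
  rewrite /rank (eqP hp') (bigD1 p) //= big1 => [|q qp].
    rewrite hp addn0 ltn_neqAle minp // andbT; apply/eqP; rewrite eqb1.
    by apply: contra pp' => /eqP E; apply/eqP/word_inj; rewrite // (eqP hp) (eqP hp').
  case: (boolP (bheight q == 1)) => //= hq.
  by rewrite ltnNge minp' // hq.
have := rank_const p' p g1 g02; rewrite rp rp' mod0n modn_small //.
Qed.
End Brick.

(** Without crossing the middle edge, the walk climbs exactly from the even heights. The height then
    determines the whole future, hence the position by aperiodicity, and the band oscillates along
    one outer edge. *)
Lemma band_low_high : nup z 1 = 0 ->
  (nup z 0 = 1 /\ nup z 2 = 0) \/ (nup z 0 = 0 /\ nup z 2 = 1).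
Proof.
move=> y0; have d1 : ndown 2 = 0 by rewrite ndownS.
have u1 t : up t -> bheight t != 1.
  move=> ut; apply/eqP => h1; move: y0; rewrite nup_sum (bigD1 t) //= ut h1 //.
have u2 t : ~~ up t -> bheight t != 2.
  move=> ut; apply/eqP => h1; move: d1; rewrite /ndown (bigD1 t) //= ut h1 //.
have uE t : up t = ~~ odd (bheight t).
  have [ut|ut] := boolP (up t).
    have := up_height_lt3 ut; have := u1 t ut.
    by case: (bheight t) => [|[|[|h]]].
  have := down_height_gt0 ut; have := u2 t ut; have := bheight_lt4 t.
  by case: (bheight t) => [|[|[|[|h]]]].
have inj p q : bheight p = bheight q -> p = q.
  move=> hE; apply: band_aperiodic => // m.
  suff E : bheight (iter m S p) = bheight (iter m S q) by rewrite !uE E.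
  by elim: m => [//|m IH]; rewrite !iterS !up_height !uE IH.
have low t : (bheight (S t) < 2) = (bheight t < 2).
  by rewrite up_height uE; have := bheight_lt4 t; case: (bheight t) => [|[|[|[|h]]]].
have low_const (s t : 'I_r) : (bheight s < 2) = (bheight t < 2).
  have [n <-] := iter_between s t; by elim: n => [//|n IH]; rewrite iterS low.
have nup1 h t : up t -> bheight t = h -> nup z h = 1.
  move=> ut ht; rewrite /nup -(card1 t); apply: eq_card => s; rewrite !inE.
  apply/andP/eqP => [[_ /eqP hs]|->]; last by rewrite ut ht eqxx.
  by apply: inj; rewrite hs ht.
have nup0 h t : (h < 2) != (bheight t < 2) -> nup z h = 0.
  move=> ne; apply: eq_card0 => s; rewrite !inE; apply/negP => /andP[_ /eqP hs].
  by rewrite -hs (low_const s t) eqxx in ne.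
pose t := Ordinal (band_size z).
have [s us] : exists s : 'I_r, up s.
  have [ut|ut] := boolP (up t); first by exists t.
  exists (S t); rewrite uE up_height (negbTE ut); move: ut; rewrite uE negbK.
  by case: (bheight t).
have := up_height_lt3 us; have := u1 s us; case hs: (bheight s) => [|[|[|h]]] // _ _.
  by left; split; [apply: nup1 hs | apply: (@nup0 2 s); rewrite hs].
by right; split; [apply: (@nup0 0 s); rewrite hs | apply: nup1 hs].
Qed.
End Aperiodic.

(** * The two exceptional vectors and the classification *)

Lemma strands_connected_low : exists p : strand 1 0 0, forall q, fconnect (@advance 1 0 0) p q.
Proof.
have [||p [p0 pp]] := @strand_ex 1 0 0 0 0 => //; exists p => q.
have rp : rises p by rewrite /rises p0.
have := pos_lt q; have := lev_lt4 q; case lq: (lev q) => [|[|[|[|h]]]] //.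
all: rewrite /edges /= => _ lt.
  by rewrite (@strand_inj _ _ _ q p) ?connect0 ?lq //; lia.
rewrite (_ : q = advance p) ?fconnect1 //; apply: strand_inj.
  by rewrite lev_advance rp p0.
by rewrite pos_advance rp p0 pp /edges /=; lia.
Qed.

Lemma strands_connected_high : exists p : strand 0 0 1, forall q, fconnect (@advance 0 0 1) p q.
Proof.
have [||p [p0 pp]] := @strand_ex 0 0 1 2 0 => //; exists p => q.
have rp : rises p by rewrite /rises p0.
have := pos_lt q; have := lev_lt4 q; case lq: (lev q) => [|[|[|[|h]]]] //.
all: rewrite /edges /= => _ lt.
  by rewrite (@strand_inj _ _ _ q p) ?connect0 ?lq //; lia.
rewrite (_ : q = advance p) ?fconnect1 //; apply: strand_inj.
  by rewrite lev_advance rp p0.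
by rewrite pos_advance rp p0 pp /edges /=; lia.
Qed.

Lemma eqn_mod_absz (x w g : nat) : (x == w %[mod g])%N = (g %| `|x%:Z - w%:Z|)%N.
Proof.
case: (leqP w x) => [le|/ltnW le].
  by rewrite eqn_mod_dvd // -(distnEl le).
by rewrite eq_sym eqn_mod_dvd // -(distnEr le).
Qed.

Lemma gtuple_eq (a b c d : int) x y w : [tuple a; b; c; d] = gtuple x y w <->
  [/\ a = - x%:Z, b = x%:Z - y%:Z, c = y%:Z - w%:Z & d = w%:Z].
Proof.
split=> [/(congr1 val) [-> -> -> ->] //|[-> -> -> ->]].
by apply: val_inj.
Qed.

Lemma bands_of_semibrick (k : fieldType) (s : seq (lmodule4 k)) :
  (forall i, (i < size s)%N -> band_brick (nth (zero_mod k) s i)) ->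
  exists t : seq (band * k), (forall l, l \in map snd t -> l != 0) /\
    s = [seq band_mod p.1 p.2 | p <- t].
Proof.
elim: s => [_|M s IH H]; first by exists [::].
have [|t [t0 ->]] := IH; first by move=> i lt; apply: (H i.+1).
have [[z [l [l0 ME]]] _] := H 0%N isT.
exists ((z, l) :: t); split=> [l'|/=]; last by congr cons.
by rewrite inE => /orP[/eqP->|/t0].
Qed.

Lemma transitive_family (k : fieldType) x y w :
  (exists p : strand x y w, forall q, fconnect (@advance x y w) p q) ->
  exists z : band, is_band_brick_family k z /\ is_family_gvector k z (gtuple x y w).
Proof.
move=> [p tr]; exists (orb p); split=> l l0; first exact: orb_brick.
by have := band_gvector (orb p) l0; rewrite !(nup_transitive tr).
Qed.

Theorem theorem6p10 (k : closedFieldType) (a b c d : int) :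
  ((exists S : lmodule4 k,
      band_semibrick S /\ is_gvector S [tuple a; b; c; d]) <->
   [/\ a <= 0, a + b <= 0, a + b + c <= 0 & a + b + c + d = 0]) /\
  ([/\ a <= 0, a + b <= 0, a + b + c <= 0 & a + b + c + d = 0] ->
   ((exists z : band,
       is_band_brick_family k z /\ is_family_gvector k z [tuple a; b; c; d]) <->
    [\/ gcdz (a + b) (b + c) = 1 /\ a + b <> 0,
        (a, b, c, d) = (-1, 1, 0, 0)
      | (a, b, c, d) = (0, 0, -1, 1)])).
Proof.
have param : [/\ a <= 0, a + b <= 0, a + b + c <= 0 & a + b + c + d = 0] ->
    exists x y w, [tuple a; b; c; d] = gtuple x y w.
  (* The numbers of climbs along the three edges are the negated partial sums of the vector. *)
  move=> [a0 b0 c0 d0]; exists (absz a), (absz (a + b)), (absz (a + b + c)).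
  by apply/gtuple_eq; split; lia.
split; first split.
- move=> [S [[s [-> /bands_of_semibrick[t [t0 ->]] _]] gS]].
  have /gtuple_eq[-> -> -> ->] := gvector_unique gS (bands_gvector t0).
  by split; lia.
- move/param => [x [y [w ->]]]; exact: semibrick_exists.
move/param => [x [y [w E]]]; have /gtuple_eq[aE bE cE dE] := E; rewrite E.
split=> [[z [zb zg]]|].
  have zb1 := zb 1 (oner_neq0 k).
  have := gvector_unique (zg 1 (oner_neq0 k)) (band_gvector z (oner_neq0 k)).
  move=> E'; have /gtuple_eq[xE yE wE wE'] : [tuple a; b; c; d] = _ := etrans E E'.
  have {xE yE wE wE'}[xE yE wE] : [/\ x = nup z 0, y = nup z 1 & w = nup z 2] by split; lia.
  have [y0|y0] := posnP y.
    have [|[x1 w0]|[x0 w1]] := @band_low_high z; first by rewrite -yE.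
      by constructor 2; rewrite aE bE cE dE xE yE wE x1 w0 -yE y0.
    by constructor 3; rewrite aE bE cE dE xE yE wE x0 w1 -yE y0.
  constructor 1; split; last by lia.
  pose g := gcdn (absz (a + b)) (absz (b + c)).
  suff : g = 1%N by rewrite /g /gcdz => ->.
  apply: (brick_coprime zb1); rewrite -?xE -?yE -?wE //.
    by rewrite (_ : y = absz (a + b)) ?dvdn_gcdl //; lia.
  apply/eqP; rewrite eqn_mod_absz (_ : x%:Z - w%:Z = b + c) ?dvdn_gcdr //; lia.
case=> [[co ab]|[ax b1 c0 d0]|[a0 b0 c1 d1]].
- apply/transitive_family/strands_connected; first by lia.
  rewrite /coprime; set g := gcdn _ _; have gy : (g %| y)%N by apply: dvdn_gcdr.
  have gd : (g %| w + x * y.-1 + y)%N by apply: dvdn_gcdl.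
  have : (x == w %[mod g])%N.
    have y0 : (0 < y)%N by lia.
    (* Modulo [g], which divides both [y] and the shift, this identity reduces to the congruence of
       [x] and [w]. *)
    have H : (w + x * y.-1 + y + x = w + x.+1 * y)%N by rewrite -{2 3}(prednK y0); nia.
    move/(congr1 (fun n => n %% g)%N): H.
    rewrite -modnDml (eqP gd) add0n -modnDmr -modnMmr (eqP gy) muln0 mod0n addn0.
    by move=> ->.
  rewrite eqn_mod_absz (_ : x%:Z - w%:Z = b + c); last by lia.
  move=> gbc; have : (g %| gcdn (absz (a + b)%R) (absz (b + c)%R))%N.
    by rewrite dvdn_gcd gbc andbT (_ : absz (a + b) = y) //; lia.
  move: co; rewrite /gcdz => -[->]; rewrite dvdn1 //.
- have -> : gtuple x y w = gtuple 1 0 0 by rewrite -E; apply/gtuple_eq; split.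
  exact/transitive_family/strands_connected_low.
have -> : gtuple x y w = gtuple 0 0 1 by rewrite -E; apply/gtuple_eq; split.
exact/transitive_family/strands_connected_high.
Qed.
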